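(* Let $\mathbf{X}$ and $\{Y\}$ be disjoint node sets in a causal DAG $\mathcal{D}$ such that $Y\in\mathrm{de}(\mathbf{X},\mathcal{D})$. Then the forbidden projection $\mathcal{D}^{\mathbf{X}Y}$ is a causal DAG if and only if there exists a valid adjustment set relative to $(\mathbf{X},Y)$ in $\mathcal{D}$.
   Context: Graph terminology. All graphs are loop-free. A path is a sequence of distinct nodes together with edges joining consecutive nodes. A path from $\mathbf{X}$ to $Y$ is proper if only its first node is in $\mathbf{X}$. It is causal (directed) if all its edges are directed edges $\rightarrow$ pointing towards the last node, otherwise non-causal. $\mathrm{de}(V,\mathcal{D})$ is the set of descendants of $V$ (including $V$), $\mathrm{an}(V,\mathcal{D})$ the set of ancestors (including $V$), $\mathrm{pa}(V,\mathcal{D})$ the set of parents; for node sets take unions. A non-endpoint node on a path is a collider if both adjoining path edges have an arrowhead at it, else a non-collider. Causal nodes and forbidden nodes. $\mathrm{cn}(\mathbf{X},Y,\mathcal{D})$ is the set of nodes on proper causal paths from $\mathbf{X}$ to $Y$, excluding nodes in $\mathbf{X}$. $\mathrm{forb}(\mathbf{X},Y,\mathcal{D})=\mathrm{de}(\mathrm{cn}(\mathbf{X},Y,\mathcal{D}),\mathcal{D})\cup\mathbf{X}$. Latent projection. For a DAG $\mathcal{D}$ with node set $\mathbf{W}\cup\mathbf{L}$, $\mathbf{W}\cap\mathbf{L}=\emptyset$, the latent projection $\mathcal{D}(\mathbf{W})$ has node set $\mathbf{W}$ and, for distinct $W_i,W_j\in\mathbf{W}$: (1) an edge $W_i\rightarrow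 W_j$ iff $\mathcal{D}$ contains a directed path $W_i\rightarrow\dots\rightarrow W_j$ on which all non-endpoint nodes are in $\mathbf{L}$; (2) an edge $W_i\leftrightarrow W_j$ iff $\mathcal{D}$ contains a path, with at least one non-endpoint node, of the form $W_i\leftarrow\dots\rightarrow W_j$ on which all non-endpoint nodes are non-colliders and in $\mathbf{L}$. Forbidden projection. For a DAG $\mathcal{D}$ with node set $\mathbf{V}$, $\mathcal{D}^{\mathbf{X}Y}=\mathcal{D}((\mathbf{V}\setminus\mathrm{forb}(\mathbf{X},Y,\mathcal{D}))\cup\mathbf{X}\cup\{Y\})$. Causal DAG. A DAG $\mathcal{D}$ on a set $\mathbf{V}$ of random variables is a causal DAG (and the joint density $f(\mathbf{v})$ is compatible with it) if for all $\mathbf{T}\subseteq\mathbf{V}$ the post-intervention density satisfies $f(\mathbf{v}\mid do(\mathbf{t}'))=\mathbf{1}(\mathbf{t}=\mathbf{t}')\prod_{V\in\mathbf{V}\setminus\mathbf{T}}f(v\mid\mathrm{pa}(V,\mathcal{D}))$. That $\mathcal{D}^{\mathbf{X}Y}$ is a causal DAG means: it is a DAG (only directed edges, no directed cycles), and this truncated factorisation with respect to $\mathcal{D}^{\mathbf{X}Y}$ holds for the marginal (post-intervention) densities of the variables that are nodes of $\mathcal{D}^{\mathbf{X}Y}$, for interventions on subsets of those variables. Valid adjustment sets. A (possibly empty) set $\mathbf{Z}\subseteq\mathbf{V}\setminus(\mathbf{X}\cup\{Y\})$ is a valid adjustment set relative to $(\mathbf{X},Y)$ in $\mathcal{D}$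 if for every density compatible with $\mathcal{D}$, $f(y\mid do(\mathbf{x}))$ equals $f(y\mid\mathbf{x})$ if $\mathbf{Z}=\emptyset$ and $\int f(y\mid\mathbf{x},\mathbf{z})f(\mathbf{z})\,d\mathbf{z}$ otherwise. By the known generalised adjustment criterion this is equivalent to: $\mathbf{Z}\cap\mathrm{forb}(\mathbf{X},Y,\mathcal{D})=\emptyset$ and every proper non-causal path from $\mathbf{X}$ to $Y$ is blocked by $\mathbf{Z}$ (it contains a non-collider in $\mathbf{Z}$ or a collider not in $\mathrm{an}(\mathbf{Z},\mathcal{D})$).
   Formalization: The formal theorem additionally assumes that no node of X is a descendant of Y; without this the claim fails, e.g. for X2 → Y → X1 with X = {X1, X2}, where the forbidden projection equals D but no valid adjustment set exists. *)

(* Defs.v *)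
From HB Require Import structures.
From mathcomp Require Import all_boot all_order all_algebra.
From mathcomp Require Import all_classical all_reals all_analysis.
From mathcomp Require Import measurable_realfun.

Set Implicit Arguments.
Unset Strict Implicit.
Unset Printing Implicit Defensive.

Import Order.TTheory GRing.Theory Num.Theory.
Import numFieldNormedType.Exports.

Local Open Scope ring_scope.

(* A directed graph with node set V is a relation [e : rel V], [e a b] meaning
   a -> b.  In an acyclic graph two nodes are joined by at most one edge, so a
   path is determined by its sequence of nodes. *)

Section Graphs.
Variable V : finType.

(* [cycle e [:: x]] is [e x x]: loops are excluded. *)
Definition acyclic (e : rel V) : Prop := forall p : seq V, cycle e p -> p = [::].

Definition de (e : rel V) (S : {set V}) : {set V} :=
  [set b | [exists a in S, connect e a b]].

(* [x :: p] is a directed path from X to Y with only its first node in X. *)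
Definition proper_causal_path (e : rel V) (X : {set V}) (Y : V)
    (x : V) (p : seq V) : Prop :=
  [/\ x \in X, path e x p, uniq (x :: p), last x p = Y
    & all (fun v => v \notin X) p].

Definition cn (e : rel V) (X : {set V}) (Y : V) : {set V} :=
  [set c | `[< exists x p, proper_causal_path e X Y x p /\ c \in x :: p >]]
    :\: X.

Definition forb (e : rel V) (X : {set V}) (Y : V) : {set V} :=
  de e (cn e X Y) :|: X.

Record mixed_graph := MixedGraph {
  nodes : {set V};
  dir : rel V;
  bidir : rel V
}.

Definition dag_graph (e : rel V) : mixed_graph :=
  MixedGraph [set: V] e (fun _ _ => false).

Definition pa (G : mixed_graph) (v : V) : {set V} :=
  [set u in nodes G | dir G u v].

Definition is_dag (G : mixed_graph) : Prop :=
  (forall a b, ~~ bidir G a b) /\ acyclic (dir G).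

Definition adjacent (e : rel V) : rel V := fun a b => e a b || e b a.

Definition latent_directed_path (e : rel V) (L : {set V}) (a b : V) : Prop :=
  exists q : seq V,
    [/\ path e a (rcons q b), uniq (a :: rcons q b) & {subset q <= L}].

(* a path a <- c ... d -> b with non-endpoint nodes [c :: q], where [d] is the
   last of them *)
Definition latent_bidirected_path (e : rel V) (L : {set V}) (a b : V) : Prop :=
  exists (c : V) (q : seq V),
    let s := a :: c :: rcons q b in
    [/\ path (adjacent e) a (behead s) /\ uniq s,
        e c a /\ e (last c q) b,
        {subset c :: q <= L}
      & forall i, (i.+2 < size s)%N ->
          ~~ (e (nth a s i) (nth a s i.+1) && e (nth a s i.+2) (nth a s i.+1))].

(* The latent nodes are those outside W. *)
Definition latent_projection (e : rel V) (W : {set V}) : mixed_graph :=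
  MixedGraph W
    (fun a b => [&& a \in W, b \in W, a != b
                  & `[< latent_directed_path e (~: W) a b >]])
    (fun a b => [&& a \in W, b \in W, a != b
                  & `[< latent_bidirected_path e (~: W) a b >]]).

Definition forbidden_projection (e : rel V) (X : {set V}) (Y : V) : mixed_graph :=
  latent_projection e (~: forb e X Y :|: X :|: [set Y]).

End Graphs.

(* The variables are real valued; [V -> R] is the type of joint values, with
   the product of the Borel sigma-algebras.  Densities take values in \bar R,
   because a marginal of a finite density may be infinite on a null set. *)

Section Densities.
Variables (V : finType) (R : realType).
Local Open Scope ereal_scope.

Definition cylinders : set (set (V -> R)) :=
  [set C | exists (v : V) (B : set R),
     measurable B /\ C = [set w : V -> R | B (w v)]]%classic.

Definition measurable_density (g : (V -> R) -> \bar R) : Prop :=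
  measurable_fun [set: g_sigma_algebraType cylinders]%classic
    (g : g_sigma_algebraType cylinders -> \bar R).

Definition set_coord (w : V -> R) (v : V) (r : R) : V -> R :=
  fun u => if u == v then r else w u.

(* Integral of g over the coordinates in S with respect to the product of the
   [mu v], the other coordinates being those of w.  It is an iterated integral,
   whose order is immaterial for measurable g >= 0 (Tonelli); for S = set0 it
   is [g w]. *)
Definition integ (mu : V -> {sigma_finite_measure set R -> \bar R})
    (S : {set V}) (g : (V -> R) -> \bar R) : (V -> R) -> \bar R :=
  foldr (fun v h w => \int[mu v]_r h (set_coord w v r)) g (enum S).

Definition agree (T : {set V}) (t w : V -> R) : bool :=
  [forall v in T, w v == t v].

(* [dens w] is f(w) and [ddo T t w] is f(w | do(t_T)): only the coordinates of
   t in T matter.  The latter is a density in the coordinates outside T, those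
   in T being set to t (it is a density with respect to the product of the
   [mu v] for v outside T and of the point masses at [t v] for v in T). *)
Record interventional_model := InterventionalModel {
  mu : V -> {sigma_finite_measure set R -> \bar R};
  dens : (V -> R) -> \bar R;
  ddo : {set V} -> (V -> R) -> (V -> R) -> \bar R;
  ddo_ge0 : forall T t w, 0 <= ddo T t w;
  ddo_measurable : forall T t, measurable_density (ddo T t);
  ddo_int1 : forall T t, integ mu (~: T) (ddo T t) t = 1;
  ddo_set0 : forall t w, ddo finset.set0 t w = dens w
}.

Definition marg (M : interventional_model) (S : {set V})
    (g : (V -> R) -> \bar R) : (V -> R) -> \bar R :=
  integ (mu M) (~: S) g.

(* k is (a version of) the conditional density f(v | A).  The product form
   determines k where 0 < f(A) < +oo. *)
Definition cond_density (M : interventional_model) (v : V) (A : {set V})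
    (k : (V -> R) -> \bar R) : Prop :=
  [/\ measurable_density k /\ (forall w, 0 <= k w),
      forall w w', (forall u, u \in v |: A -> w u = w' u) -> k w = k w',
      forall w, integ (mu M) [set v] k w = 1
    & forall w,
        marg M (v |: A) (dens M) w = k w * marg M A (dens M) w].

(* The node set of G may be a proper subset of V; the densities are then the
   marginal ones. *)
Definition truncated_factorisation (M : interventional_model)
    (G : mixed_graph V) : Prop :=
  exists k : V -> (V -> R) -> \bar R,
    (forall v, v \in nodes G -> cond_density M v (pa G v) (k v)) /\
    (forall (T : {set V}) (t w : V -> R), T \subset nodes G ->
       marg M (nodes G) (ddo M T t) w =
       (if agree T t w then 1 else 0) * \prod_(v in nodes G :\: T) k v w).

Definition causal_dag (M : interventional_model) (G : mixed_graph V) : Prop :=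
  is_dag G /\ truncated_factorisation M G.

(* f(y | do(x)), with x and y the coordinates of w in X and at Y *)
Definition do_density (M : interventional_model) (X : {set V}) (Y : V)
    (w : V -> R) : \bar R :=
  marg M (Y |: X) (ddo M X w) w.

(* f(y | a), meaningful where 0 < f(a) < +oo *)
Definition cond_ratio (M : interventional_model) (Y : V) (A : {set V})
    (w : V -> R) : \bar R :=
  marg M (Y |: A) (dens M) w / marg M A (dens M) w.

(* The right-hand side of the adjustment formula is well defined at the value
   x of X: 0 < f(x,z) < +oo for f(z)dz-almost every z (if Z is empty, this is
   0 < f(x) < +oo). *)
Definition positivity (M : interventional_model) (X Z : {set V})
    (w : V -> R) : Prop :=
  integ (mu M) Z
    (fun u => if 0 < marg M (X :|: Z) (dens M) u < +oo then 0
              else marg M Z (dens M) u) w = 0.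

Definition adjustment (M : interventional_model) (X : {set V}) (Y : V)
    (Z : {set V}) (w : V -> R) : \bar R :=
  if Z == finset.set0 then cond_ratio M Y X w
  else integ (mu M) Z
         (fun u => cond_ratio M Y (X :|: Z) u * marg M Z (dens M) u) w.

End Densities.

(* The quantification over M includes the reference measures, so that discrete
   as well as continuous variables are covered. *)
Definition valid_adjustment_set (R : realType) (V : finType) (e : rel V)
    (X : {set V}) (Y : V) (Z : {set V}) : Prop :=
  Z \subset ~: (X :|: [set Y]) /\
  forall M : interventional_model V R, causal_dag M (dag_graph e) ->
    forall w : V -> R, positivity M X Z w ->
      do_density M X Y w = adjustment M X Y Z w.

(* Main.v *)
(* Write D for de(cn(X,Y)).  The forbidden projection is a DAG iff X does not
   meet D.  If some node of X lies in D, there is a fork x <- ... <- d -> ... -> Y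
   inside D, which projects to x <-> Y; and no Z is valid, because trees of
   copied fair coins refute it: either Z contains a copy of the mediator between
   some treatment x0 and Y, and conditioning on it hides the effect of x0, or Z
   misses the tree in which x and Y copy a common ancestor.
   If X misses D, let g be the integral of the product of the kernels of D over
   all coordinates of D except Y.  The nodes of D outside cn integrate out, so g
   depends only on Y and on the parents of cn outside cn.  These are the parents
   of Y in the projection, and g is its conditional density; it gives the
   truncated factorisation.  The parents are also in X or not descendants of X,
   so the complement of de(X) is a valid adjustment set. *)

From HB Require Import structures.
Require Import Defs.
From mathcomp Require Import all_boot all_order all_algebra.
From mathcomp Require Import all_classical all_reals all_analysis.
From mathcomp Require Import measurable_realfun lra.

Set Implicit Arguments.
Unset Strict Implicit.
Unset Printing Implicit Defensive.

Import Order.TTheory GRing.Theory Num.Theory.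
Import numFieldNormedType.Exports.

Local Open Scope ring_scope.

(** * Iterated integrals *)

(** The condition that no node of [X] descends from [Y] excludes graphs such as [x1 -> Y -> x2] on
    three nodes with [X = {x1, x2}]. There nothing is latent and the projection is the graph itself,
    yet the empty set, the only candidate, fails to adjust because it conditions on the effect [x2].
    In the proof the condition keeps the node at which the fork opens different from [Y].

    Conditional densities are determined only almost everywhere, while the factorisation is asserted
    at every point. The work is therefore done with kernels normalised at every value of their
    parents: products of them integrate out factor by factor, and the resulting identities hold
    pointwise. Null sets enter only through [positivity].

    The adjustment formula is claimed only under [positivity], so a countermodel has to satisfy it.
    If [Z] contains a copy of the mediator, the treatment [x0] must not determine the mediator, or
    some values of [(x, z)] with [f(z) > 0] would have [f(x, z) = 0]. This is why that link is noisy
    while all the others are exact copies. *)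

Definition depends_on (V : finType) (T U : Type) (A : {set V}) (g : (V -> T) -> U) :=
  forall w w', (forall u, u \in A -> w u = w' u) -> g w = g w'.

Lemma depends_onS (V : finType) (T U : Type) (A B : {set V}) (g : (V -> T) -> U) :
  A \subset B -> depends_on A g -> depends_on B g.
Proof. by move=> /fintype.subsetP AB gA w w' ww'; apply: gA => u /AB; exact: ww'. Qed.

(** Both degenerate cases give zero: the numerator vanishes for [y = 0], and the inverse vanishes
    for [y = +oo]. Hence [cond_ratio] has the harmless value [0] wherever it is meaningless. *)
Lemma mul_div_ereal (R : realType) (x y : \bar R) : (0 <= y)%E ->
  (x * y / y = if 0 < y < +oo then x else 0)%E.
Proof.
move=> y0; case: ifPn => [/andP[yp yoo]|].
  rewrite -muleA; have yfin : y \is a fin_num by rewrite ge0_fin_numE.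
  by rewrite divee ?mule1// gt_eqF.
rewrite negb_and -!leNgt => /orP[yle|]; last first.
  by rewrite leye_eq => /eqP ->; rewrite invey mule0.
by rewrite (_ : y = 0) ?mule0 ?mul0e//; apply/eqP; rewrite eq_le yle.
Qed.

Section Integration.
Variables (V : finType) (R : realType).
Local Open Scope ereal_scope.

Local Notation state := (g_sigma_algebraType (@cylinders V R)).
Implicit Types (g h : (V -> R) -> \bar R) (A B S T : {set V}) (u v : V)
  (w : V -> R).

Definition nneg_density g := measurable_density g /\ forall w, 0 <= g w.

Lemma measurable_coord v :
  measurable_fun [set: state]%classic (fun w : state => (w : V -> R) v).
Proof.
move=> _ B mB; rewrite setTI; apply: sub_sigma_algebra.
by exists v, B.
Qed.

Lemma measurable_into_state d (T : measurableType d) (f : T -> V -> R) :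
  (forall v, measurable_fun [set: T]%classic (fun x => f x v)) ->
  measurable_fun [set: T]%classic (f : T -> state).
Proof.
move=> mf; apply: (@measurability _ _ T state setT f (@cylinders V R)) => //.
move=> _ [_ [v [B [mB ->]]] <-].
exact: mf.
Qed.

Lemma measurable_set_coord v :
  measurable_fun [set: state * R]%classic
    ((fun x : state * R => set_coord (x.1 : V -> R) v x.2) : state * R -> state).
Proof.
apply: measurable_into_state => u; rewrite /set_coord.
case: (u == v); first exact: measurable_snd.
exact: (measurableT_comp (measurable_coord u) measurable_fst).
Qed.

Lemma measurable_set_coord2 w u v :
  measurable_fun [set: R * R]%classic
    ((fun x : R * R => set_coord (set_coord w u x.1) v x.2) : R * R -> state).
Proof.
apply: measurable_into_state => t; rewrite /set_coord.
case: (t == v); first exact: measurable_snd.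
by case: (t == u); [exact: measurable_fst | exact: measurable_cst].
Qed.

Lemma measurable_set_coord1 w v :
  measurable_fun [set: R]%classic ((fun r => set_coord w v r) : R -> state).
Proof.
by apply: measurable_into_state => t; rewrite /set_coord; case: (t == v).
Qed.

Lemma set_coord_swap w u v (r s : R) : u != v ->
  set_coord (set_coord w u r) v s = set_coord (set_coord w v s) u r.
Proof.
move=> uv; apply/funext => t; rewrite /set_coord.
by case: (t =P v) => [->|//]; rewrite eq_sym (negbTE uv).
Qed.

Lemma nneg_density1 : nneg_density (fun=> 1).
Proof. by split => //; exact: measurable_cst. Qed.

Lemma nneg_densityM g h : nneg_density g -> nneg_density h ->
  nneg_density (fun w => g w * h w).
Proof.
by move=> [mg g0] [mh h0]; split=> [|w]; [exact: emeasurable_funM|exact: mule_ge0].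
Qed.

Lemma nneg_density_prod S (k : V -> (V -> R) -> \bar R) :
  {in S, forall v, nneg_density (k v)} ->
  nneg_density (fun w => \prod_(v in S) k v w).
Proof.
move=> kS; rewrite -[X in nneg_density X]/(fun w => _).
have -> : (fun w => \prod_(v in S) k v w) =
    foldr (fun v h w => k v w * h w) (fun=> 1) (enum S).
  apply/funext => w; rewrite -big_enum /=.
  by elim: (enum S) => [|v s IH]; rewrite ?big_nil// big_cons IH.
have : {subset enum S <= S} by move=> v; rewrite mem_enum.
elim: (enum S) => [|v s IH] sS /=; first exact: nneg_density1.
apply: nneg_densityM; first by apply: kS; apply: sS; rewrite mem_head.
by apply: IH => u us; apply: sS; rewrite inE us orbT.
Qed.

Lemma nneg_density_if F g h :
  nneg_density F -> nneg_density g -> nneg_density h ->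
  nneg_density (fun w => if 0 < F w < +oo then g w else h w).
Proof.
move=> [mF _] [mg g0] [mh h0]; split=> [|w]; last by case: ifP.
apply: measurable_fun_ifT => //; apply: measurable_and; apply: measurable_fun_lte => //;
  exact: measurable_cst.
Qed.

Variable mu : V -> {sigma_finite_measure set R -> \bar R}.

Let step v h w := \int[mu v]_r h (set_coord w v r).

Let step_nneg v h : nneg_density h -> nneg_density (step v h).
Proof.
move=> [mh h0]; split=> [|w]; last by apply: integral_ge0 => r _; exact: h0.
apply: (@measurable_fun_fubini_tonelli_F _ _ state R R (mu v)
  (fun x : state * R => h (set_coord x.1 v x.2))) => //.
exact: (measurableT_comp mh (measurable_set_coord v)).
Qed.

Let step_swap u v h : nneg_density h -> step u (step v h) = step v (step u h).
Proof.
move=> [mh h0]; have [->//|uv] := eqVneq u v.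
apply/funext => w; rewrite /step.
rewrite (@fubini_tonelli _ _ R R R (mu u) (mu v)
  (fun x : R * R => h (set_coord (set_coord w u x.1) v x.2)))//; last first.
  exact: (measurableT_comp mh (measurable_set_coord2 w u v)).
by under eq_integral do under eq_integral do rewrite set_coord_swap//.
Qed.

Let integs (s : seq V) g := foldr step g s.

Let integs_nneg s g : nneg_density g -> nneg_density (integs s g).
Proof. by move=> gn; elim: s => //= v s; exact: step_nneg. Qed.

Let integs_step v s g : nneg_density g ->
  integs s (step v g) = step v (integs s g).
Proof.
move=> gn; elim: s => //= u s ->.
by rewrite step_swap//; exact: integs_nneg.
Qed.

Let integs_cat s t g : integs (s ++ t) g = integs s (integs t g).
Proof. exact: foldr_cat. Qed.

(** Tonelli lets every coordinate be moved to the front, so the order of [enum] is immaterial and a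
    set of coordinates can be split at will. *)
Let integs_perm s t g : nneg_density g -> perm_eq s t -> integs s g = integs t g.
Proof.
move=> gn; elim: s t => [|v s IH] t; first by rewrite perm_sym => /perm_nilP ->.
move=> st; have vt : v \in t by rewrite -(perm_mem st) mem_head.
have [t1 [t2 def_t]] : exists t1 t2, t = t1 ++ v :: t2.
  by case/splitPr: vt => t1 t2; exists t1, t2.
have {}st : perm_eq s (t1 ++ t2).
  rewrite -(perm_cons v) (perm_trans st)// def_t perm_sym -cat1s.
  by rewrite -[v :: t2]cat1s perm_catCA.
rewrite def_t /= (IH _ st) !integs_cat [integs (v :: t2) g]/=.
by rewrite integs_step//; exact: integs_nneg.
Qed.

Lemma integ_nneg S g : nneg_density g -> nneg_density (integ mu S g).
Proof. exact: integs_nneg. Qed.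

Lemma integ_set0 g : integ mu finset.set0 g = g.
Proof. by rewrite /integ enum_set0. Qed.

Lemma integ_set1 v g w : integ mu [set v] g w = \int[mu v]_r g (set_coord w v r).
Proof. by rewrite /integ enum_set1. Qed.

Lemma integ_setU A B g : nneg_density g -> [disjoint A & B] ->
  integ mu (A :|: B) g = integ mu A (integ mu B g).
Proof.
move=> gn AB; rewrite /integ -foldr_cat; apply: integs_perm => //.
apply: uniq_perm; rewrite ?enum_uniq// ?cat_uniq ?enum_uniq ?andbT /=.
  apply/hasPn => v; rewrite !mem_enum => vB.
  by rewrite (disjointFl AB vB).
by move=> v; rewrite mem_cat !mem_enum inE.
Qed.

Lemma integ_setD A B g : nneg_density g -> B \subset A ->
  integ mu A g = integ mu (A :\: B) (integ mu B g).
Proof.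
move=> gn BA; rewrite -integ_setU//; last first.
  by rewrite disjoint_sym finset.disjoints_subset; apply/fintype.subsetP => v;
    rewrite !inE => ->.
by congr (integ mu _ g); apply/finset.setP => v; rewrite !inE;
  case: (boolP (v \in B)) => [/(fintype.subsetP BA)->|_];
  rewrite ?orbT ?orbF ?andbF ?andbT.
Qed.

Lemma depends_on_integ A S g : depends_on A g ->
  depends_on (A :\: S) (integ mu S g).
Proof.
move=> gA; have : depends_on [set v in A | v \notin enum S] (integs (enum S) g).
  elim: (enum S) => [|v s IH] w w' ww' /=.
    by apply: gA => u uA; apply: ww'; rewrite inE uA.
  apply: eq_integral => r _; apply: IH => u; rewrite inE => /andP[uA us].
  rewrite /set_coord; case: eqP => // /eqP uv.
  by apply: ww'; rewrite !inE uA (negbTE uv).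
apply: depends_onS; apply/fintype.subsetP => v.
by rewrite !inE mem_enum andbC.
Qed.

Lemma integZl S g h : nneg_density g -> nneg_density h -> depends_on (~: S) g ->
  integ mu S (fun w => g w * h w) = (fun w => g w * integ mu S h w).
Proof.
move=> [_ g0] hn gS; rewrite /integ -/(integs _ _) -/(integs _ _).
have : {subset enum S <= S} by move=> v; rewrite mem_enum.
elim: (enum S) => //= v s IH sS.
rewrite IH; last by move=> u us; apply: sS; rewrite inE us orbT.
apply/funext => w; rewrite /step.
have gw r : g (set_coord w v r) = g w.
  apply: gS => u; rewrite inE /set_coord.
  by case: eqP => // ->; rewrite sS ?mem_head.
under eq_integral do rewrite gw.
have [mi i0] := integs_nneg s hn.
by rewrite ge0_integralZl//; exact: (measurableT_comp mi (measurable_set_coord1 w v)).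
Qed.

Lemma le_integ S g h : nneg_density g -> nneg_density h ->
  (forall w, g w <= h w) -> forall w, integ mu S g w <= integ mu S h w.
Proof.
move=> gn hn gh; rewrite /integ -/(integs _ _) -/(integs _ _).
elim: (enum S) => //= v s IH w.
have [mi i0] := integs_nneg s hn; have [mj j0] := integs_nneg s gn.
apply: ge0_le_integral => //.
- exact: (measurableT_comp mj (measurable_set_coord1 w v)).
- exact: (measurableT_comp mi (measurable_set_coord1 w v)).
Qed.

Lemma integ_add S g h : nneg_density g -> nneg_density h ->
  integ mu S (fun w => g w + h w) = (fun w => integ mu S g w + integ mu S h w).
Proof.
move=> gn hn; rewrite /integ -!/(integs _ _).
elim: (enum S) => //= v s ->; apply/funext => w.
have [mi i0] := integs_nneg s hn; have [mj j0] := integs_nneg s gn.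
rewrite /step ge0_integralD//.
- exact: (measurableT_comp mj (measurable_set_coord1 w v)).
- exact: (measurableT_comp mi (measurable_set_coord1 w v)).
Qed.

Lemma integ_zero S w :
  integ mu S (fun=> 0) w = 0.
Proof.
have n0 : nneg_density (fun _ : V -> R => 0 : \bar R).
  by split=> //; exact: measurable_cst.
have /= := congr1 (@^~ w) (@integZl S _ _ n0 n0 (fun _ _ _ => erefl)).
rewrite (_ : (fun w => _) = fun=> 0); first by move=> ->; rewrite mul0e.
by apply/funext => u; rewrite mule0.
Qed.

End Integration.

(** * Acyclic graphs and Markov kernels *)

Section Acyclic.
Variables (V : finType) (e : rel V).

Lemma acyclic_intro :
  (forall a b, e a b -> ~~ connect e b a) -> acyclic e.
Proof.
move=> noback [//|x [|y p]] /=.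
  by rewrite andbT => /[dup] /noback; rewrite connect0.
case/andP=> exy yp; move: (noback _ _ exy).
by rewrite (_ : connect e y x)//; apply/connectP; exists (rcons p x); rewrite ?last_rcons.
Qed.

Hypothesis acyclic_e : acyclic e.

Lemma acyclic_edge a b : e a b -> ~~ connect e b a.
Proof.
move=> eab; apply/negP => /connectP[p bp ap].
suff : rcons (belast b p) a = [::] by case: (belast b p).
by apply: acyclic_e; rewrite ap -lastI /= rcons_path bp -ap.
Qed.

Lemma acyclic_irrefl a : e a a = false.
Proof. by apply/negP => /acyclic_edge; rewrite connect0. Qed.

Lemma acyclic_antisym a b : connect e a b -> connect e b a -> a = b.
Proof.
move=> /connectP[[|c p] /=]; first by [].
case/andP=> eac cp def_b ba.
have := acyclic_edge eac; rewrite (connect_trans _ ba)//.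
by apply/connectP; exists p.
Qed.

Lemma acyclic_uniq x p : path e x p -> uniq (x :: p).
Proof.
elim: p x => [//|y p IH] x /= /andP[exy yp]; rewrite -/(uniq (y :: p)) IH// andbT.
apply/negP => xp; have := acyclic_edge exy.
by rewrite (path_connect yp xp).
Qed.

(** A node of [S] from which the fewest nodes are reachable works: along an edge the reachable set
    shrinks strictly, since acyclicity forbids a return. *)
Lemma acyclic_sink (S : {set V}) : S != finset.set0 ->
  exists2 v, v \in S & forall u, u \in S -> ~~ e v u.
Proof.
case/set0Pn=> x xS; case: (arg_minnP (fun v => #|connect e v|) xS) => v vS min_v.
exists v => // u uS; apply/negP => evu; have := min_v _ uS.
rewrite leqNgt => /negP; apply; apply: proper_card; apply/fintype.properP; split.
  by apply/fintype.subsetP => t; apply: connect_trans; exact: connect1.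
by exists v; [exact: connect0 | exact: acyclic_edge].
Qed.

Lemma mem_de (S : {set V}) b :
  reflect (exists2 a, a \in S & connect e a b) (b \in de e S).
Proof. by rewrite inE; apply: (iffP existsP) => -[a]; [case/andP|]; exists a => //;
  apply/andP. Qed.

Lemma de_closed (S : {set V}) a b : a \in de e S -> e a b -> b \in de e S.
Proof.
move=> /mem_de[c cS ca] eab; apply/mem_de; exists c => //.
exact: connect_trans ca (connect1 eab).
Qed.

Lemma de_connect (S : {set V}) a b : a \in de e S -> connect e a b -> b \in de e S.
Proof.
by move=> /mem_de[c cS ca] ab; apply/mem_de; exists c => //; exact: connect_trans ab.
Qed.

Lemma sub_de (S : {set V}) : S \subset de e S.
Proof. by apply/fintype.subsetP => a aS; apply/mem_de; exists a. Qed.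

End Acyclic.

Section Kernels.
Variables (V : finType) (R : realType).
Local Open Scope ereal_scope.
Variable mu : V -> {sigma_finite_measure set R -> \bar R}.

Definition parents (e : rel V) v : {set V} := [set u | e u v].

Definition is_kernel (A : {set V}) (v : V) (k : (V -> R) -> \bar R) :=
  [/\ nneg_density k, depends_on (v |: A) k & forall w, integ mu [set v] k w = 1].

Lemma depends_on_prod (A S : {set V}) (k : V -> (V -> R) -> \bar R) :
  {in S, forall v, depends_on A (k v)} ->
  depends_on A (fun w => \prod_(v in S) k v w).
Proof. by move=> kA w w' ww'; apply: eq_bigr => v vS; exact: kA. Qed.

Variables (e : rel V) (k : V -> (V -> R) -> \bar R).

Lemma kernels_depend (A S : {set V}) :
  {in S, forall v, is_kernel (parents e v) v (k v)} ->
  {in S, forall v, v \in A} -> (forall u v, v \in S -> e u v -> u \in A) ->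
  depends_on A (fun w => \prod_(v in S) k v w).
Proof.
move=> kS SA eA; apply: depends_on_prod => v vS; have [_ kv _] := kS _ vS.
apply: depends_onS kv; apply/fintype.subsetP => u; rewrite !inE => /predU1P[->|/eA/(_)].
  exact: SA.
exact.
Qed.

Lemma kernels_nneg (S : {set V}) :
  {in S, forall v, is_kernel (parents e v) v (k v)} ->
  nneg_density (fun w => \prod_(v in S) k v w).
Proof. by move=> kS; apply: nneg_density_prod => v /kS[]. Qed.

Hypothesis acyclic_e : acyclic e.

(* Integrate out one sink at a time. *)
Lemma integ_kernels (S : {set V}) g :
  {in S, forall v, is_kernel (parents e v) v (k v)} ->
  nneg_density g -> depends_on (~: S) g ->
  integ mu S (fun w => g w * \prod_(v in S) k v w) = g.
Proof.
move: {2}#|S| (erefl #|S|) => n; elim: n S => [|n IH] S.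
  move/eqP; rewrite cards_eq0 => /eqP -> _ _ _; rewrite integ_set0.
  by apply/funext => w; rewrite big_set0 mule1.
move=> cardS kS gn gS.
have [|v vS v_sink] := @acyclic_sink _ e acyclic_e S.
  by rewrite -card_gt0 cardS.
have kS' : {in S :\ v, forall u, is_kernel (parents e u) u (k u)}.
  by move=> u; rewrite !inE => /andP[_ /kS].
have [kvn _ kv1] := kS _ vS.
rewrite (@integ_setD _ _ _ _ [set v]) ?finset.sub1set//; last first.
  exact: nneg_densityM gn (kernels_nneg kS).
rewrite (_ : (fun w => _) = (fun w => (g w * \prod_(u in S :\ v) k u w) * k v w));
  last first.
  by apply/funext => w; rewrite (big_setD1 v)//= [k v w * _]muleC muleA.
rewrite integZl//; last 2 first.
- exact: nneg_densityM gn (kernels_nneg kS').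
- move=> w w' ww'; congr (_ * _).
    by apply: gS => u; rewrite inE => uS; apply: ww'; rewrite !inE;
      apply: contraNneq uS => ->.
  apply: (kernels_depend kS') ww' => [u|t u]; rewrite !inE; first by case/andP.
  by case/andP=> _ /v_sink nvu etu; apply: contraNneq nvu => <-.
rewrite (_ : (fun w => _) = (fun w => g w * \prod_(u in S :\ v) k u w)); last first.
  by apply/funext => w; rewrite kv1 mule1.
apply: IH => //; last first.
  by apply: depends_onS gS; apply/fintype.subsetP => u;
    rewrite !inE negb_and negbK => ->; rewrite orbT.
by move: cardS; rewrite (cardsD1 v) vS => -[].
Qed.

Lemma integ_kernels1 (S : {set V}) w :
  {in S, forall v, is_kernel (parents e v) v (k v)} ->
  integ mu S (fun w => \prod_(v in S) k v w) w = 1.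
Proof.
move=> kS; have := congr1 (@^~ w) (integ_kernels kS (@nneg_density1 V R) (fun _ _ _ =>
  erefl)).
move=> /= E; rewrite -[RHS]E; congr (integ mu S _ w).
by apply/funext => t; rewrite mul1e.
Qed.

Hypothesis kP : forall v, is_kernel (parents e v) v (k v).

Lemma prod_setC (D : {set V}) w :
  \prod_v k v w = \prod_(v in ~: D) k v w * \prod_(v in D) k v w.
Proof.
rewrite (bigID (mem D)) muleC; congr (_ * _).
by apply: eq_bigl => v; rewrite finset.in_setC.
Qed.

(** As no edge leaves [D], the kernels outside [D] do not see its coordinates, and the kernels
    inside integrate to one in the marginal of [A]. The first factor is thus a conditional density
    of [B] given [A]. It is used for [Y] in the projection and for single nodes of the
    countermodels. *)
Lemma marg_closed (A B D : {set V}) :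
  (forall a b, a \in D -> e a b -> b \in D) -> [disjoint A & D] -> B \subset D ->
  depends_on (B :|: A) (integ mu (D :\: B) (fun w => \prod_(v in D) k v w)) ->
  forall w, integ mu (~: (B :|: A)) (fun w => \prod_v k v w) w =
    integ mu (D :\: B) (fun w => \prod_(v in D) k v w) w *
    integ mu (~: A) (fun w => \prod_v k v w) w.
Proof.
move=> D_closed AD BD; set g := integ _ (D :\: B) _ => gAB.
have kS (S : {set V}) : {in S, forall v, is_kernel (parents e v) v (k v)} by [].
have P0_dep : depends_on (~: D) (fun w => \prod_(v in ~: D) k v w).
  apply: (kernels_depend (kS (~: D))) => [v|u v]; rewrite ?inE // => vD euv.
  by apply: contra vD => uD; exact: D_closed euv.
have fE : (fun w => \prod_v k v w) =
    (fun w => \prod_(v in ~: D) k v w * \prod_(v in D) k v w).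
  by apply/funext => w; exact: prod_setC.
have P0n := kernels_nneg (kS (~: D)); have P1n := kernels_nneg (kS D).
have gn : nneg_density g by exact: integ_nneg.
have fn := nneg_densityM P0n P1n.
have nA u : u \in D -> u \notin A by move=> uD; rewrite (disjointFl AD uD).
move=> w; rewrite fE (@integ_setD _ _ _ (~: (B :|: A)) (D :\: B))//; last first.
  apply/fintype.subsetP => u; rewrite !inE negb_or => /andP[-> /nA] //.
rewrite (@integ_setD _ _ _ (~: A) D)//; last first.
  by apply/fintype.subsetP => u; rewrite !inE => /nA.
rewrite integ_kernels// integZl//; last first.
  by apply: depends_onS P0_dep; apply/fintype.subsetP => u;
    rewrite !inE negb_and orbC => ->.
have -> : ~: (B :|: A) :\: (D :\: B) = ~: A :\: D.
  apply/finset.setP => u; rewrite !inE negb_and negbK negb_or.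
  by case: (boolP (u \in B)) => [/(fintype.subsetP BD)->|_] //=; rewrite ?andbF// andbC.
rewrite (_ : (fun w => _) = (fun w => g w * \prod_(v in ~: D) k v w)); last first.
  by apply/funext => t; rewrite muleC.
rewrite integZl//.
apply: depends_onS gAB; apply/fintype.subsetP => u; rewrite !inE negb_and negbK.
by move=> /orP[/(fintype.subsetP BD)->|uA] //; rewrite negbK uA orbT.
Qed.

End Kernels.

(** * Forbidden nodes and the bidirected edge *)

Section Fork.
Variables (V : finType) (e : rel V).
Hypothesis acyclic_e : acyclic e.

Let no_collider (s : seq V) := forall x0 i, (i.+2 < size s)%N ->
  ~~ (e (nth x0 s i) (nth x0 s i.+1) && e (nth x0 s i.+2) (nth x0 s i.+1)).

Let asym a b : e a b -> e b a = false.
Proof.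
by move=> eab; apply/negP => /connect1; apply/negP; exact: acyclic_edge.
Qed.

Let no_collider_directed d r : path e d r -> no_collider (d :: r).
Proof.
elim: r d => [//|y [//|z r] IH] d /= /and3P[edy eyz zr] x0 [_|i] /=.
  by rewrite (asym eyz) andbF.
by apply: IH => /=; rewrite eyz.
Qed.

(** Each node moved to the front adds one triple, centred at a node with an edge pointing towards
    the front, hence not a collider. *)
Let no_collider_rev q d r : path e d q -> no_collider (d :: r) ->
  no_collider (rev q ++ d :: r).
Proof.
elim: q d r => [//|y q IH] d r /= /andP[edy yq] nc.
rewrite rev_cons cat_rcons; apply: IH => // x0 [/= _|i]; last exact: nc.
by rewrite (asym edy).
Qed.

Lemma fork_latent_bidirected (L : {set V}) d q r a b :
  path e d (rcons q a) -> path e d (rcons r b) ->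
  uniq (rev (rcons q a) ++ d :: rcons r b) ->
  {subset q <= L} -> {subset r <= L} -> d \in L ->
  latent_bidirected_path e L a b.
Proof.
move=> dq dr uqr qL rL dL.
(* The definition singles out the first latent node; it is the last node of [q], or [d] itself if
   [q] is empty. *)
have [c [t def_t]] : exists c t, rev q ++ d :: r = c :: t.
  by case: (rev q) => [|c t]; [exists d, r | exists c, (t ++ d :: r)].
have c_last : c = last d q.
  by move: def_t; case/lastP: q {dq uqr qL} => [|q x] /=;
    rewrite ?rev_rcons ?last_rcons => -[->].
have t_last : last c t = last d r.
  by rewrite -[LHS]/(last c (c :: t)) -def_t last_cat.
have sE : a :: c :: rcons t b = rev (rcons q a) ++ d :: rcons r b.
  by rewrite rev_rcons -rcons_cons -def_t rcons_cat.
exists c, t; split; last 1 first.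
- move=> i; rewrite sE; apply: no_collider_rev => //.
  exact: no_collider_directed.
- split; last by rewrite sE.
  suff : path (Defs.adjacent e) a (rcons (rev q) d ++ rcons r b).
    by rewrite cat_rcons -rcons_cons -rcons_cat def_t.
  rewrite cat_path last_rcons; apply/andP; split; last first.
    by apply: sub_path dr => x y; rewrite /Defs.adjacent => ->.
  have := rev_path (Defs.adjacent e) d (rcons q a).
  rewrite last_rcons belast_rcons rev_cons => ->.
  by apply: sub_path dq => x y; rewrite /Defs.adjacent => ->; rewrite orbT.
- by move: dq dr; rewrite t_last c_last !rcons_path => /andP[_ ->] /andP[_ ->].
- move=> x; rewrite -def_t mem_cat mem_rev inE.
  by case/or3P => [/qL//|/eqP->//|/rL].
Qed.

End Fork.

Lemma path_connect_last (V : finType) (e : rel V) a p u :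
  path e a p -> u \in a :: p -> connect e u (last a p).
Proof.
move=> ap u_ap; case/splitPl: u_ap ap => p1 p2 <-.
by rewrite cat_path last_cat => /andP[_ p2P]; apply/connectP; exists p2.
Qed.

Section Forbidden.
Variables (V : finType) (e : rel V) (X : {set V}) (Y : V).
Hypothesis acyclic_e : acyclic e.
Hypothesis YX : Y \notin X.

(** Only the heads of edges are tested, so a path may start in [X], as proper causal paths do. *)
Definition avoiding : rel V := [rel a b | e a b && (b \notin X)].

Lemma avoiding_path a p :
  path avoiding a p = path e a p && all (fun v => v \notin X) p.
Proof.
by elim: p a => //= b p IH a; rewrite IH -!andbA; do !bool_congr.
Qed.

Lemma avoiding_connect a b : connect avoiding a b -> connect e a b.
Proof. by apply: connect_sub => u v /andP[uv _]; exact: connect1. Qed.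

Lemma avoiding_notin a b : connect avoiding a b -> a \notin X -> b \notin X.
Proof.
case/connectP=> p; rewrite avoiding_path => /andP[_ pX] -> aX.
by have : all (fun v => v \notin X) (a :: p) by [apply/andP]; move/allP; apply;
  exact: mem_last.
Qed.

(** Acyclicity makes every walk a path, so the two halves through [c] can be concatenated without
    looking for repeated nodes. *)
Lemma cnP c : reflect
  (exists2 x, x \in X & [/\ connect avoiding x c, connect avoiding c Y & c \notin X])
  (c \in cn e X Y).
Proof.
rewrite !inE; apply: (iffP andP) => [[cX /asboolP[x [p [[xX xp _ pY pX] cp]]]]|].
  have xpX : path avoiding x p by rewrite avoiding_path xp.
  exists x => //; move: cp; rewrite inE => /predU1P[cx|cp].
    by rewrite cx xX in cX.
  case/splitPr: cp xpX pY => p1 p2.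
  rewrite cat_path last_cat /= => /and3P[xp1 lc cp2] pY; split=> //.
    by apply/connectP; exists (rcons p1 c); rewrite ?last_rcons// rcons_path xp1.
  by apply/connectP; exists p2.
move=> [x xX [/connectP[p xp pc] /connectP[q cq qY] cX]]; split=> //.
move: xp cq; rewrite !avoiding_path => /andP[xp pX] /andP[cq qX].
have xpq : path e x (p ++ q) by rewrite cat_path xp -pc.
apply/asboolP; exists x, (p ++ q); split; first split=> //.
- exact: (acyclic_uniq acyclic_e xpq).
- by rewrite last_cat -pc.
- by rewrite all_cat pX.
by rewrite -cat_cons mem_cat pc mem_last.
Qed.

Lemma last_in_X u : u \in de e X -> exists2 x, x \in X & connect avoiding x u.
Proof.
case/mem_de=> x xX /connectP[p xp ->].
have : exists2 x', x' \in X & connect avoiding x' x by exists x.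
elim: p x {xX} xp => //= y p IH x /andP[exy yp] [x' x'X x'x]; apply: IH => //.
have [yX|yX] := boolP (y \in X); first by exists y.
by exists x' => //; apply: connect_trans x'x (connect1 _); apply/andP.
Qed.

Lemma first_in_X a b : connect e a b -> a \notin X -> b \in X ->
  exists p x, [/\ connect avoiding a p, e p x & x \in X].
Proof.
case/connectP=> q aq ->; elim: q a aq => [a _ /negP//|y q IH a /= /andP[eay yq] aX qX].
have [yX|yX] := boolP (y \in X); first by exists a, y.
have [p [x [yp epx xX]]] := IH _ yq yX qX.
exists p, x; split=> //; apply: connect_trans yp; apply: connect1.
by apply/andP.
Qed.

Lemma cn_sub_de : cn e X Y \subset de e X.
Proof.
apply/fintype.subsetP => c /cnP[x xX [xc _ _]]; apply/mem_de; exists x => //.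
exact: avoiding_connect.
Qed.

Lemma end_in_cn : Y \in de e X -> Y \in cn e X Y.
Proof. by case/last_in_X=> x xX xY; apply/cnP; exists x. Qed.

(** A proper path reaching [u] would continue through [c] to [Y] and make [u] itself a causal
    node. *)
Lemma parent_cn_nonde u c : c \in cn e X Y -> e u c ->
  u \notin cn e X Y -> u \notin X -> u \notin de e X.
Proof.
move=> /cnP[x xX [xc cY cX]] euc ucn uX; apply: contra ucn.
case/last_in_X=> x' x'X x'u; apply/cnP; exists x' => //; split=> //.
by apply: connect_trans cY; apply: connect1; apply/andP.
Qed.

(** A proper causal path starts with [x0 -> c], and a path returning to [X] enters it first by
    [p -> x]. These nodes serve both directions of the theorem: the fork is found among the
    descendants of [c], and the trees of the countermodels are rooted at [c]. *)
Lemma meets_X_witness : ~~ [disjoint X & de e (cn e X Y)] ->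
  exists x0 c p x, [/\ x0 \in X /\ x \in X, c \notin X, e x0 c,
    connect avoiding c Y & connect avoiding c p /\ e p x].
Proof.
case/pred0Pn=> b /andP[/= bX /mem_de[c0 /cnP[x0 x0X [x0c0 c0Y c0X]] c0b]].
have [p [x [c0p epx xX]]] := first_in_X c0b c0X bX.
case/connectP: x0c0 => -[|c q] /=; first by move=> _ c0x0; rewrite c0x0 x0X in c0X.
case/andP=> /andP[ex0c cX] cq def_c0.
have cc0 : connect avoiding c c0 by apply/connectP; exists q.
by exists x0, c, p, x; split=> //; [|split=> //]; apply: connect_trans cc0 _.
Qed.

Let W := ~: forb e X Y :|: X :|: [set Y].

Lemma mem_latent u :
  (u \in ~: W) = [&& u \in de e (cn e X Y), u \notin X & u != Y].
Proof.
rewrite /W /forb !(finset.in_setC, finset.in_setU, finset.in_set1).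
by case: (u \in X); case: (u \in de _ _); case: (u == Y).
Qed.

(** The fork opens at the last node [d] of a path from [c] to [p] that still reaches [Y] outside
    [X]. No later node on the way to [x] reaches [Y] in this manner, so the two branches cannot
    meet. *)
Lemma bidirected_of_meets_X : Y \in de e X -> [disjoint X & de e [set Y]] ->
  ~~ [disjoint X & de e (cn e X Y)] ->
  exists2 x, x \in X & latent_bidirected_path e (~: W) x Y.
Proof.
move=> YdeX XdeY /meets_X_witness[x0 [c [p [x [[x0X xX] cX ex0c cY [cp epx]]]]]].
have ccn : c \in cn e X Y.
  apply/cnP; exists x0; first by [].
  by split=> //; apply: connect1; apply/andP.
have inL u : connect avoiding c u -> u != Y -> u \in ~: W.
  move=> cu uY; rewrite mem_latent uY (avoiding_notin cu cX) !andbT.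
  apply: (de_connect (fintype.subsetP (sub_de _ _) _ ccn)).
  exact: avoiding_connect.
have [d [q [dq qp dY qNY cd]]] : exists d q, [/\ path avoiding d q, last d q = p,
    connect avoiding d Y, all (fun u => ~~ connect avoiding u Y) q
    & connect avoiding c d].
  case/connectP: (cp) => q cq ->; elim: q c cq cY {ccn cX ex0c cp inL} => [|y q IH] a /=.
    by move=> _ aY; exists a, [::]; split.
  move=> /andP[eay yq] aY.
  have [yY|yY] := boolP (connect avoiding y Y).
    have [d [q' [dq' q'p dY q'NY yd]]] := IH _ yq yY.
    by exists d, q'; split=> //; apply: connect_trans (connect1 eay) yd.
  have [/hasP[z zq zY]|/hasPn qN] := boolP (has (fun u => connect avoiding u Y) q).
    by have := connect_trans (path_connect yq (mem_behead (s := y :: q) zq)) zY;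
      rewrite (negbTE yY).
  exists a, (y :: q); split=> //=; first exact/andP.
  by rewrite yY; apply/allP.
(* Here it matters that [x] does not descend from [Y]: with [d = Y] the fork would degenerate into a
   directed path from [Y] to [x]. *)
have YNx : ~~ connect e Y x.
  apply/negP => Yx; move/pred0P: XdeY => /(_ x) /=; rewrite xX /=.
  by case/mem_de; exists Y; rewrite ?inE.
have dp : connect avoiding d p by apply/connectP; exists q.
have dNY : d != Y.
  apply: contraNneq YNx => <-; apply: connect_trans (connect1 epx).
  exact: avoiding_connect.
case/connectP: dY => r; case/lastP: r => [|r z]; first by move=> _ /eqP;
  rewrite eq_sym (negbTE dNY).
rewrite last_rcons => dr def_z; subst z.
exists x => //.
have dqe : path e d (rcons q x).
  by move: dq; rewrite avoiding_path => /andP[dq _]; rewrite rcons_path dq qp.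
have dre : path e d (rcons r Y) by move: dr; rewrite avoiding_path => /andP[].
have conq u : u \in d :: q -> connect avoiding c u.
  by move=> uq; apply: connect_trans cd (path_connect dq uq).
have conr u : u \in d :: r -> connect avoiding c u.
  move=> ur; apply: connect_trans cd (path_connect dr _).
  by rewrite -rcons_cons mem_rcons inE ur orbT.
have uq := acyclic_uniq acyclic_e dqe; have ur := acyclic_uniq acyclic_e dre.
have rY u : u \in d :: rcons r Y -> connect avoiding u Y.
  by move=> /(path_connect_last dr); rewrite last_rcons.
have rX u : u \in d :: rcons r Y -> u \notin X.
  move=> u_r; apply: avoiding_notin (path_connect dr u_r) _.
  exact: avoiding_notin cd cX.
apply: (fork_latent_bidirected acyclic_e dqe dre).
- rewrite cat_uniq rev_uniq ur andbT; move: uq; rewrite cons_uniq => /andP[_ ->] /=.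
  rewrite -/(has _ (d :: rcons r Y)); apply/hasPn => u u_r.
  suff : u \notin rev (rcons q x) by []; rewrite mem_rev mem_rcons inE negb_or;
    apply/andP; split.
    by apply: contraNneq (rX u u_r) => ->.
  by apply/negP => /(allP qNY); rewrite (rY u u_r).
- move=> u u_q; apply: inL; first by apply: conq; rewrite inE u_q orbT.
  by apply: contraTneq (allP qNY _ u_q) => ->; rewrite connect0.
- move=> u u_r; apply: inL; first by apply: conr; rewrite inE u_r orbT.
  move: ur; rewrite -rcons_cons rcons_uniq inE negb_or => /andP[/andP[_ Yr] _].
  by apply: contraNneq Yr => <-.
- exact: inL.
Qed.

End Forbidden.

(** * The conditional density of Y in the projection *)

Section Model.
Variables (V : finType) (R : realType) (e : rel V).
Local Open Scope ereal_scope.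

Lemma nneg_density_agree (T : {set V}) (t : V -> R) :
  nneg_density (fun w => if agree T t w then 1 else 0 : \bar R).
Proof.
have -> : (fun w => if agree T t w then 1 else 0 : \bar R) =
    (fun w => \prod_(v in T) (\1_[set t v]%classic (w v))%:E).
  apply/funext => w; case: ifPn => [/forallP ag|/forallPn[v]].
    rewrite big1// => v vT; have := ag v; rewrite vT => /eqP ->.
    by rewrite indicE mem_set.
  rewrite negb_imply => /andP[vT /eqP wv]; rewrite (bigD1 v)//= indicE memNset ?mul0e//.
apply: nneg_density_prod => v _; split=> [|w]; last by rewrite lee_fin indicE.
apply/measurable_EFinP; apply: measurableT_comp (measurable_coord v).
by apply: measurable_indic; exact: measurable_set1.
Qed.

Lemma depends_on_agree (T : {set V}) (t : V -> R) :
  depends_on T (fun w => if agree T t w then 1 else 0 : \bar R).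
Proof.
move=> w w' ww'; congr (if _ then _ else _).
by apply: eq_forallb => v; case: (boolP (v \in T)) => // /ww' ->.
Qed.

Lemma model_kernels (M : interventional_model V R) :
  causal_dag M (dag_graph e) ->
  exists k : V -> (V -> R) -> \bar R,
    [/\ forall v, is_kernel (mu M) (parents e v) v (k v),
        forall v, cond_density M v (pa (dag_graph e) v) (k v),
        forall T t w, ddo M T t w =
          (if agree T t w then 1 else 0) * \prod_(v in ~: T) k v w
      & dens M = fun w => \prod_v k v w].
Proof.
move=> [_ [k [kP ddoP]]]; exists k.
have paE v : pa (dag_graph e) v = parents e v by apply/finset.setP => u; rewrite !inE.
have ddoE T t w : ddo M T t w =
    (if agree T t w then 1 else 0) * \prod_(v in ~: T) k v w.
  have := ddoP T t w (finset.subsetT _); rewrite /marg /= finset.setCT integ_set0 => ->.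
  by rewrite finset.setTD.
split=> //.
- by move=> v; have [[mk k0] kd k1 _] := kP v (finset.in_setT _); split=> //;
  rewrite -paE.
- by move=> v; exact: kP (finset.in_setT _).
- apply/funext => w; rewrite -(@ddo_set0 _ _ M w w) ddoE.
  rewrite (_ : agree _ _ _ = true) ?mul1e ?finset.setC0; last by apply/forallP => v;
    rewrite inE.
  by apply: eq_bigl => v; rewrite inE.
Qed.

Lemma do_densityE (M : interventional_model V R) (k : V -> (V -> R) -> \bar R)
    (X : {set V}) (Y : V) w :
  (forall v, is_kernel (mu M) (parents e v) v (k v)) ->
  (forall t u, ddo M X t u =
    (if agree X t u then 1 else 0) * \prod_(v in ~: X) k v u) ->
  do_density M X Y w =
    integ (mu M) (~: (Y |: X)) (fun u => \prod_(v in ~: X) k v u) w.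
Proof.
move=> kP ddoE; rewrite /do_density /marg (_ : ddo M X w = fun u =>
    (if agree X w u then 1 else 0) * \prod_(v in ~: X) k v u); last first.
  by apply/funext => u; exact: ddoE.
have kX : {in ~: X, forall v, is_kernel (mu M) (parents e v) v (k v)} by [].
rewrite integZl; last 3 first.
- exact: nneg_density_agree.
- exact: kernels_nneg kX.
- apply: depends_onS (@depends_on_agree _ _).
  by rewrite finset.setCK finset.subsetUr.
by rewrite (_ : agree _ _ _ = true) ?mul1e//; apply/forallP => v; apply/implyP.
Qed.

End Model.

(* C and D stand for cn(X,Y) and its set of descendants. *)
Section Response.
Variables (V : finType) (R : realType) (e : rel V) (Y : V) (C D : {set V}).
Local Open Scope ereal_scope.
Hypothesis acyclic_e : acyclic e.
Hypothesis CD : C \subset D.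
Hypothesis YC : Y \in C.
Hypothesis D_closed : forall a b, a \in D -> e a b -> b \in D.
Hypothesis C_up : forall u c, u \in D -> c \in C -> e u c -> u \in C.
Variables (mu : V -> {sigma_finite_measure set R -> \bar R})
  (k : V -> (V -> R) -> \bar R).
Hypothesis kP : forall v, is_kernel mu (parents e v) v (k v).

Let YD : Y \in D. Proof. exact: (fintype.subsetP CD). Qed.

Definition outer_parents := [set u | (u \notin C) && [exists c in C, e u c]].

Let O := outer_parents.

Lemma outer_parentsP u : reflect (exists2 c, c \in C & u \notin C /\ e u c) (u \in O).
Proof.
rewrite finset.inE; apply: (iffP andP) => [[uC /existsP[c /andP[cC euc]]]|[c cC [uC
  euc]]].
  by exists c.
by split=> //; apply/existsP; exists c; rewrite cC.
Qed.

Lemma outer_parents_notin u : u \in O -> u \notin D.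
Proof.
by case/outer_parentsP=> c cC [uC euc]; apply: contra uC => uD; exact: C_up euc.
Qed.

Let kS (S : {set V}) : {in S, forall v, is_kernel mu (parents e v) v (k v)}.
Proof. by []. Qed.

(* A version of f(y | pa(Y)), with the parents taken in the projection. *)
Definition response := integ mu (D :\ Y) (fun w => \prod_(v in D) k v w).

Lemma response_nneg : nneg_density response.
Proof. by apply: integ_nneg; exact: kernels_nneg. Qed.

(* The nodes of D outside C have no child in C, so they integrate to 1. *)
Lemma response_depends : depends_on (Y |: O) response.
Proof.
have -> : response = integ mu (C :\ Y) (fun w => \prod_(v in C) k v w).
  rewrite /response (@integ_setD _ _ _ _ (D :\: C)) //; last 2 first.
  - exact: kernels_nneg.
  - by apply/fintype.subsetP => u; rewrite !finset.in_setD finset.in_set1 => /andP[uC ->];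
    rewrite andbT; apply: contraNneq uC => ->.
  rewrite (_ : (fun w => _) = (fun w => \prod_(v in C) k v w * \prod_(v in D :\: C) k v
    w)); last first.
    by apply/funext => w; rewrite (big_setID C)/= (finset.setIidPr CD).
  rewrite (integ_kernels acyclic_e (@kS (D :\: C)))//; last 2 first.
  - exact: kernels_nneg.
  - apply: (kernels_depend (@kS C)) => [v vC|u v vC euv];
    rewrite finset.in_setC finset.in_setD negb_and negbK ?vC//.
    case: (boolP (u \in D)) => [uD|]; rewrite ?orbT// orbF.
    exact: C_up euv.
  congr (integ mu _ _); apply/finset.setP => u;
    rewrite !finset.in_setD !finset.in_set1 negb_and negbK.
  by case: (boolP (u \in C)) => [/(fintype.subsetP CD)->|_] //=;
    rewrite ?andbT ?andbF ?orbF //; case: (u \in D); rewrite /= ?andbF.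
apply: depends_onS (depends_on_integ (A := C :|: O) _ _).
  apply/fintype.subsetP => u; rewrite !finset.in_setD !finset.in_setU !finset.in_set1
    negb_and negbK.
  by case: (u == Y) => //=; case: (u \in C).
apply: (kernels_depend (@kS C)) => [v vC|u v vC euv]; rewrite finset.in_setU ?vC//.
by case: (boolP (u \in C)) => //= uC; apply/outer_parentsP; exists v.
Qed.

Lemma response_int1 w : integ mu [set Y] response w = 1.
Proof.
rewrite /response -integ_setU//; last 2 first.
- exact: kernels_nneg.
- by rewrite disjoints1 !inE eqxx.
by rewrite finset.setD1K// (integ_kernels1 acyclic_e w (@kS D)).
Qed.

Lemma marg_response (A : {set V}) w : O \subset A -> [disjoint A & D] ->
  integ mu (~: (Y |: A)) (fun w => \prod_v k v w) w =
  response w * integ mu (~: A) (fun w => \prod_v k v w) w.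
Proof.
move=> OA AD; apply: (marg_closed acyclic_e kP) => //.
- by rewrite finset.sub1set.
- apply: depends_onS response_depends; exact: finset.setUS.
Qed.

(** The set [T] meets [D] at most in [Y]. If [Y] is intervened on, the other kernels of [D]
    integrate to one and no factor for [Y] remains; otherwise all kernels of [D] are present and
    integrate to [response]. *)
Lemma response_truncated (T : {set V}) t w : T \subset ~: (D :\ Y) ->
  integ mu (D :\ Y)
    (fun w => (if agree T t w then 1 else 0) * \prod_(v in ~: T) k v w) w =
  (if agree T t w then 1 else 0) *
    \prod_(v in ~: (D :\ Y) :\: T) (if v == Y then response else k v) w.
Proof.
move=> /fintype.subsetP TW.
have T_D u : u \in T -> u \in D -> u = Y.
  by move=> /TW + uD; rewrite finset.in_setC finset.in_setD1 uD andbT negbK => /eqP.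
rewrite integZl; last 3 first.
- exact: nneg_density_agree.
- exact: (kernels_nneg (@kS (~: T))).
- by apply: depends_onS (@depends_on_agree _ _ _ _); exact/fintype.subsetP.
congr (_ * _).
pose S := ~: T :\: D.
have SE : {in S, forall v, (if v == Y then response else k v) = k v}.
  by move=> v; rewrite finset.in_setD => /andP[vD _]; case: eqP vD => // ->; rewrite YD.
have Sdep : depends_on (~: D) (fun w => \prod_(v in S) k v w).
  apply: (kernels_depend (@kS S)) => [v|u v]; rewrite finset.in_setD => /andP[vD _].
    by rewrite finset.in_setC.
  by move=> euv; rewrite finset.in_setC; apply: contra vD => uD; exact: D_closed euv.
have Sdep' : depends_on (~: (D :\ Y)) (fun w => \prod_(v in S) k v w).
  by apply: depends_onS Sdep; rewrite finset.setCS finset.subsetDl.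
rewrite (_ : (fun w => _) = (fun w => \prod_(v in S) k v w * \prod_(v in ~: T :&: D) k
  v w)); last first.
  by apply/funext => u; rewrite (big_setID D)/= muleC.
have [YT|YT] := boolP (Y \in T).
  have -> : ~: T :&: D = D :\ Y.
    apply/finset.setP => u; rewrite !inE; case: (boolP (u \in D));
      rewrite ?andbF// !andbT => uD.
    apply/idP/idP => [uT|]; first by apply: contraNneq uT => ->.
    by apply: contra => uT; rewrite (T_D u).
  rewrite (integ_kernels acyclic_e (@kS (D :\ Y)))//; last exact: (kernels_nneg (@kS S)).
  rewrite (_ : ~: (D :\ Y) :\: T = S); last first.
    apply/finset.setP => u; rewrite !inE negb_and negbK andbC andb_orl.
    by case: (u =P Y) => [->|_]; rewrite ?YT ?YD //= ?andbF.
  by apply: eq_bigr => v /SE ->.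
have -> : ~: T :&: D = D.
  apply/finset.setP => u; rewrite !inE; case: (boolP (u \in D));
    rewrite ?andbF// andbT => uD.
  by apply/negP => uT; move: YT; rewrite -(T_D u) ?uT.
rewrite integZl//; last 2 first.
- exact: (kernels_nneg (@kS S)).
- exact: (kernels_nneg (@kS D)).
rewrite (_ : ~: (D :\ Y) :\: T = Y |: S); last first.
  apply/finset.setP => u; rewrite !inE negb_and negbK andbC andb_orl [X in _ || X]andbC.
  by case: (u =P Y) => [->|_]; rewrite ?YT //= andbC.
rewrite finset.big_setU1/=; last by rewrite !inE YD.
rewrite eqxx muleC; congr (_ * _).
by apply: eq_bigr => v /SE ->.
Qed.

(** * Integrating out the descendants of the treatments *)

Section Nondescendants.
Variable X : {set V}.
Let Dx := de e X.
Hypothesis D_Dx : D \subset Dx.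
Hypothesis XD : [disjoint X & D].
Hypothesis O_Dx : {in O, forall u, u \in Dx -> u \in X}.

Let nondesc_depends : depends_on (~: Dx) (fun w => \prod_(v in ~: Dx) k v w).
Proof.
apply: (kernels_depend (@kS (~: Dx))) => // u v; rewrite !finset.in_setC => vD euv.
by apply: contra vD => uD; exact: de_closed uD euv.
Qed.

Lemma integ_descendants w :
  integ mu Dx (fun w => \prod_v k v w) w = \prod_(v in ~: Dx) k v w.
Proof.
rewrite (_ : (fun w => _) = (fun w => \prod_(v in ~: Dx) k v w * \prod_(v in Dx) k v w)).
  by rewrite (integ_kernels acyclic_e (@kS Dx))//; exact: (kernels_nneg (@kS (~: Dx))).
by apply/funext => u; exact: prod_setC.
Qed.

Lemma do_response w :
  integ mu (~: (Y |: X)) (fun w => \prod_(v in ~: X) k v w) w =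
  integ mu (~: Dx) (fun w => response w * \prod_(v in ~: Dx) k v w) w.
Proof.
have X_Dx u : u \in X -> u \in Dx by exact: (fintype.subsetP (sub_de e X)).
have D_Dx' u : u \in D -> u \in Dx by exact: (fintype.subsetP D_Dx).
have X_D u : u \in D -> u \notin X by move=> uD; rewrite (disjointFl XD uD).
have n1 := kernels_nneg (@kS (~: X)); have n2 := kernels_nneg (@kS (~: Dx)).
(* The descendants of [X] outside [X] and [D]: neither [response] nor the kernels of nondescendants
   see them, so their own kernels integrate to one. *)
pose B := Dx :\: X :\: D; have n3 := kernels_nneg (@kS B).
have n4 := kernels_nneg (@kS (~: X :\: D)); have n5 := kernels_nneg (@kS D).
have YDx : Y \in Dx by exact: D_Dx'.
have YX : Y \notin X by exact: X_D.
rewrite (@integ_setD _ _ _ _ (D :\ Y))//; last first.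
  apply/fintype.subsetP => u; rewrite finset.in_setD1 finset.in_setC finset.in_setU1
    negb_or.
  by case/andP=> -> /X_D.
rewrite (_ : ~: (Y |: X) :\: (D :\ Y) = ~: Dx :|: B); last first.
  apply/finset.setP => u; rewrite !(finset.in_setD, finset.in_setU, finset.in_setC,
    finset.in_set1).
  case: (u =P Y) => [->|_] /=; first by rewrite YDx YD.
  case: (boolP (u \in D)) => [uD|_] /=; first by rewrite (D_Dx' _ uD).
  by case: (boolP (u \in X)) => [/X_Dx->|_] //=; case: (u \in Dx).
rewrite integ_setU; last 2 first.
- exact: integ_nneg.
- by rewrite disjoint_sym finset.disjoints_subset finset.setCK;
  apply/fintype.subsetP => u; rewrite !finset.in_setD => /andP[_ /andP[]].
congr (integ mu (~: Dx) _ w).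
rewrite (_ : (fun w => _) = (fun w => \prod_(v in ~: X :\: D) k v w * \prod_(v in D) k
  v w)); last first.
  apply/funext => u; rewrite (big_setID D)/= muleC; congr (_ * _); apply: eq_bigl => v.
  by rewrite finset.in_setI finset.in_setC; case: (boolP (v \in D)) => [/X_D->|];
    rewrite ?andbF.
rewrite integZl//; last first.
  apply: (kernels_depend (@kS (~: X :\: D))) => [v|u v];
    rewrite finset.in_setD => /andP[vD _].
    by rewrite finset.in_setC finset.in_setD1 negb_and vD orbT.
  rewrite finset.in_setC finset.in_setD1 negb_and => euv; apply/orP; right.
  by apply: contra vD => uD; exact: D_closed euv.
rewrite (_ : (fun w => _) =
    (fun w => (response w * \prod_(v in ~: Dx) k v w) * \prod_(v in B) k v w));
      last first.
  apply/funext => u; rewrite muleC -muleA; congr (_ * _).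
  rewrite (big_setID (~: Dx))/=; congr (_ * _); apply: eq_bigl => v;
    rewrite !(finset.in_setD, finset.in_setI, finset.in_setC) ?negbK.
    case: (boolP (v \in Dx)) => vDx /=; rewrite ?andbF// andbT.
    by apply/andP; split; apply: contra vDx; [exact: D_Dx'|exact: X_Dx].
  by rewrite andbC andbA.
apply: (integ_kernels acyclic_e (@kS B)) => //.
  by apply: nneg_densityM => //; exact: response_nneg.
move=> u u' uu'; congr (_ * _); last first.
  by apply: nondesc_depends => v; rewrite finset.in_setC => vDx; apply: uu';
    rewrite finset.in_setC !finset.in_setD (negbTE vDx) !andbF.
apply: response_depends => v; rewrite finset.in_setU1 => vYO; apply: uu'.
rewrite finset.in_setC !finset.in_setD.
case/predU1P: vYO => [->|/O_Dx vX]; first by rewrite YD.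
by case: (boolP (v \in Dx)) => [/vX->|_]; rewrite ?andbF.
Qed.

End Nondescendants.

End Response.

(** * Projection and adjustment when X has no forbidden node *)

Section NoForbiddenTreatment.
Variables (V : finType) (e : rel V) (X : {set V}) (Y : V).
Local Open Scope ereal_scope.
Hypothesis acyclic_e : acyclic e.
Hypothesis YX : Y \notin X.
Hypothesis Y_de_X : Y \in de e X.
Hypothesis XD0 : [disjoint X & de e (cn e X Y)].

Let C := cn e X Y.
Let D := de e C.
Let W := ~: forb e X Y :|: X :|: [set Y].

Let DX u : u \in D -> u \notin X.
Proof. by move=> uD; rewrite (disjointFl XD0). Qed.

Let CD : C \subset D. Proof. exact: sub_de. Qed.

Let YC : Y \in C. Proof. exact: end_in_cn. Qed.

Let YD : Y \in D. Proof. exact: (fintype.subsetP CD). Qed.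

Let D_closed a b : a \in D -> e a b -> b \in D. Proof. exact: de_closed. Qed.

Lemma de_cn_avoiding u v : u \in D -> connect e u v -> connect (avoiding e X) u v.
Proof.
move=> uD /connectP[p up ->]; elim: p u uD up => //= w p IH u uD /andP[euw wp].
have wD := D_closed uD euw.
by apply: connect_trans (IH _ wD wp); apply: connect1; apply/andP; split=> //; exact: DX.
Qed.

Lemma de_cn_anc u : u \in D -> connect e u Y -> u \in C.
Proof.
move=> uD uY; case/mem_de: (uD) => c cC cu.
have [x xX [xc _ _]] := elimT (cnP X Y acyclic_e c) cC.
apply/(cnP X Y acyclic_e); exists x => //; split; [|exact: de_cn_avoiding|exact: DX].
by apply: connect_trans xc (de_cn_avoiding _ cu); exact: (fintype.subsetP CD).
Qed.

Lemma de_cn_up u c : u \in D -> c \in C -> e u c -> u \in C.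
Proof.
move=> uD /(cnP X Y acyclic_e)[x _ [_ /avoiding_connect cY _]] euc.
by apply: de_cn_anc => //; exact: connect_trans (connect1 euc) cY.
Qed.

Lemma nodes_projectionE : W = ~: (D :\ Y).
Proof.
apply/finset.setP => u; rewrite -[LHS]negbK -finset.in_setC mem_latent finset.in_setC
  finset.in_setD1.
by rewrite -/C -/D; case: (boolP (u \in D)) => [/DX ->|_]; rewrite ?andbF// andbC.
Qed.

Lemma outer_parents_de u : u \in outer_parents e C -> u \in de e X -> u \in X.
Proof.
case/outer_parentsP=> c cC [uC euc]; apply: contraLR => uX.
exact: parent_cn_nonde cC euc uC uX.
Qed.

Lemma dir_connect a b : dir (forbidden_projection e X Y) a b ->
  a != b /\ connect e a b.
Proof.
case/and4P=> _ _ ab /asboolP[q [aq _ _]]; split=> //.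
by apply/connectP; exists (rcons q b); rewrite ?last_rcons.
Qed.

(** A latent node lies in [D], which no edge leaves, so [Y] is the only node of [W] it can point to.
    A bidirected edge would therefore join [Y] to itself. *)
Lemma is_dag_projection : is_dag (forbidden_projection e X Y).
Proof.
split=> [a b|].
  apply/negP => /and4P[aW bW ab /asboolP[c [q [_ [eca edb] cqL _]]]].
  have in_W_de u v : u \in ~: W -> e u v -> v \in W -> v = Y.
    rewrite nodes_projectionE finset.setCK finset.in_setD1 => /andP[_ uD] euv.
    by rewrite finset.in_setC finset.in_setD1 (D_closed uD euv) andbT negbK => /eqP.
  move: ab; rewrite (in_W_de _ _ (cqL _ (mem_head _ _)) eca aW).
  by rewrite (in_W_de _ _ (cqL _ (mem_last _ _)) edb bW) eqxx.
apply: acyclic_intro => a b /dir_connect[ab cab]; apply: contra ab => ba.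
apply/eqP/(acyclic_antisym acyclic_e cab).
by apply: connect_sub ba => u v /dir_connect[].
Qed.

(** A directed path through a latent node stays in [D] from there on, so outside [D] only the
    original edges arrive. *)
Lemma pa_projection v : v \in ~: D -> pa (forbidden_projection e X Y) v = pa (dag_graph
  e) v.
Proof.
rewrite finset.in_setC => vD; have vW : v \in W.
  by rewrite nodes_projectionE finset.in_setC finset.in_setD1 (negbTE vD) andbF.
apply/finset.setP => u; rewrite [in LHS]finset.in_set [in RHS]finset.in_set /=
  finset.in_setT /=; apply/idP/idP.
  case/andP=> uW /and4P[_ _ uv /asboolP[q]].
  case/lastP: q => [[/= /andP[]]//|q x [uq _ qL]].
  have : x \in ~: W by apply: qL; rewrite mem_rcons mem_head.
  rewrite nodes_projectionE finset.setCK finset.in_setD1 => /andP[_ xD].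
  move: uq; rewrite rcons_path last_rcons => /andP[_ /(D_closed xD)].
  by rewrite (negbTE vD).
move=> euv; have uW : u \in W.
  rewrite nodes_projectionE finset.in_setC finset.in_setD1 negb_and; apply/orP; right.
  by apply: contra vD => uD; exact: D_closed euv.
have uv : u != v by apply: contraTneq euv => ->; rewrite acyclic_irrefl.
rewrite uW vW uv; apply/asboolP; exists [::]; split=> //; first by rewrite /= euv.
by rewrite [rcons _ _]/= cons_uniq mem_seq1 uv.
Qed.

Lemma pa_projection_Y_notin u : u \in pa (forbidden_projection e X Y) Y -> u \notin D.
Proof.
rewrite finset.in_set => /andP[uW /and4P[_ _ uY _]].
by move: uW; rewrite [nodes _]nodes_projectionE finset.in_setC finset.in_setD1 uY.
Qed.

(** Inclusion is what [cond_density] asks for, as it only bounds the coordinates on which a kernel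
    may depend. The edge comes from [u -> c] followed by a causal path to [Y], whose inner nodes are
    latent. *)
Lemma outer_parents_projection :
  outer_parents e C \subset pa (forbidden_projection e X Y) Y.
Proof.
apply/fintype.subsetP => u uO; have uD := outer_parents_notin de_cn_up uO.
case/outer_parentsP: uO => c cC [uC euc].
have inW v : v \notin D -> v \in W.
  by move=> vD; rewrite nodes_projectionE finset.in_setC finset.in_setD1 (negbTE vD)
    andbF.
have uY : u != Y by apply: contraNneq uD => ->.
have YW : Y \in W by rewrite nodes_projectionE finset.in_setC finset.in_setD1 eqxx.
rewrite finset.in_set /= inW//= YW uY /=; apply/asboolP.
have [x _ [_ cY _]] := elimT (cnP X Y acyclic_e c) cC.
case/connectP: cY => p cp def_Y.
have up : path e u (c :: p) by move: cp; rewrite avoiding_path /= euc => /andP[].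
have uq := acyclic_uniq acyclic_e up.
have Dp v : v \in c :: p -> v \in D.
  move=> vp; apply: (de_connect (fintype.subsetP CD _ cC));
    apply: (@avoiding_connect _ e X).
  exact: (path_connect cp vp).
move: up uq Dp; rewrite lastI -def_Y => up uq Dp.
exists (belast c p); split=> // v vq; rewrite -/W nodes_projectionE finset.setCK
  finset.in_setD1.
rewrite Dp ?mem_rcons ?inE ?vq ?orbT// andbT.
by move: uq; rewrite /= rcons_uniq => /and3P[_ + _]; apply: contraNneq => <-.
Qed.

Section Models.
Variables (R : realType) (M : interventional_model V R).
Local Open Scope ereal_scope.
Hypothesis causal_M : causal_dag M (dag_graph e).

Lemma causal_dag_projection : causal_dag M (forbidden_projection e X Y).
Proof.
split; first exact: is_dag_projection.
have [k [kP kc ddoE densE]] := model_kernels causal_M.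
exists (fun v => if v == Y then response Y D (mu M) k else k v); split.
  move=> v; rewrite [nodes _]nodes_projectionE => vW; have [->|vY] := eqVneq v Y.
    have [rm r0] := response_nneg Y D kP; split=> //.
    - have rd := response_depends acyclic_e CD YC de_cn_up kP.
      apply: depends_onS rd; apply: finset.setUS; exact: outer_parents_projection.
    - exact: (response_int1 acyclic_e CD YC kP).
    - rewrite /marg densE => w; apply: (marg_response acyclic_e CD YC D_closed de_cn_up
      kP).
        exact: outer_parents_projection.
      rewrite finset.disjoints_subset; apply/fintype.subsetP => u /pa_projection_Y_notin.
      by rewrite finset.in_setC.
  have vD : v \in ~: D.
    by move: vW; rewrite !finset.in_setC finset.in_setD1 vY.
  by rewrite pa_projection//; exact: kc.
move=> T t w TW; rewrite /marg [nodes _]nodes_projectionE finset.setCK.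
rewrite (_ : ddo M T t = fun w => (if agree T t w then 1 else 0) * \prod_(v in ~: T) k
  v w); last first.
  by apply/funext => u; exact: ddoE.
rewrite (response_truncated acyclic_e CD YC D_closed kP)//.
by rewrite -nodes_projectionE.
Qed.

(** With [q] the density of [Z], intervening gives the integral of [g * q], and adjusting gives the
    same integral restricted to the points where [f(x, z)] is positive and finite. The rest has mass
    zero by [positivity]. *)
Lemma adjustment_nondescendants w : positivity M X (~: de e X) w ->
  do_density M X Y w = adjustment M X Y (~: de e X) w.
Proof.
have [k [kP kc ddoE densE]] := model_kernels causal_M.
set Z := ~: de e X; set g := response Y D (mu M) k.
have gn : nneg_density g by exact: response_nneg kP.
pose q w := \prod_(v in Z) k v w.
have kS (S : {set V}) : {in S, forall v, is_kernel (mu M) (parents e v) v (k v)} by [].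
have qn : nneg_density q by exact: (kernels_nneg (kS Z)).
have D_Dx : D \subset de e X.
  apply/fintype.subsetP => u /mem_de[c cC]; apply: de_connect.
  exact: (fintype.subsetP (cn_sub_de X Y acyclic_e) _ cC).
have doE : do_density M X Y w = integ (mu M) Z (fun w => g w * q w) w.
  rewrite (do_densityE _ _ kP (ddoE X)).
  apply: (do_response acyclic_e CD YC D_closed de_cn_up kP D_Dx XD0).
  exact: outer_parents_de.
have qE : marg M Z (dens M) = q.
  rewrite /marg densE finset.setCK; apply/funext => u.
  exact: (integ_descendants acyclic_e kP).
pose F := marg M (X :|: Z) (dens M).
have Fn : nneg_density F.
  apply: integ_nneg; rewrite densE.
  have := kernels_nneg (kS [set: V]).
  by congr nneg_density; apply/funext => u; apply: eq_bigl => v; rewrite finset.in_setT.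
have ratioE u : cond_ratio M Y (X :|: Z) u = if 0 < F u < +oo then g u else 0.
  rewrite /cond_ratio -/F /marg densE.
  rewrite (marg_response acyclic_e CD YC D_closed de_cn_up kP); last 2 first.
  - apply/fintype.subsetP => v vO; rewrite finset.in_setU finset.in_setC.
    by case: (boolP (v \in de e X)) => [/(outer_parents_de vO)->|]; rewrite ?orbT.
  - rewrite disjoint_sym finset.disjoints_subset; apply/fintype.subsetP => v vD.
    by rewrite finset.in_setC finset.in_setU finset.in_setC negb_or negbK DX//;
      exact: (fintype.subsetP D_Dx).
  have FE : integ (mu M) (~: (X :|: Z)) (fun w => \prod_v k v w) = F by rewrite /F
    /marg densE.
  by rewrite FE mul_div_ereal//; case: Fn.
rewrite doE /positivity /adjustment qE; case: eqP => [Z0|_].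
  have -> : cond_ratio M Y X w = if 0 < F w < +oo then g w else 0.
    by rewrite -ratioE Z0 finset.setU0.
  have q1 : q = fun=> 1.
    by apply/funext => u; rewrite /q Z0 big_set0.
  (* For empty [Z] the integral in [positivity] is its integrand at [w], and the degenerate case
     would read [1 = 0]. *)
  rewrite Z0 !integ_set0 q1 -Z0 -/F; case: ifP => _ => [_|/eqP]; first by rewrite mule1.
  by rewrite onee_eq0.
rewrite -/F => bad0.
have bad_n : nneg_density (fun u => if 0 < F u < +oo then 0 else q u).
  by apply: nneg_density_if => //; split => //; exact: measurable_cst.
have gbad_n := nneg_densityM gn bad_n.
have good_n : nneg_density (fun u => if 0 < F u < +oo then g u * q u else 0).
  apply: nneg_density_if => //; first exact: nneg_densityM.
  by split => //; exact: measurable_cst.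
have -> : (fun u => cond_ratio M Y (X :|: Z) u * q u) =
    fun u => if 0 < F u < +oo then g u * q u else 0.
  by apply/funext => u; rewrite ratioE; case: ifP => //; rewrite mul0e.
have -> : (fun u => g u * q u) = fun u =>
    (if 0 < F u < +oo then g u * q u else 0) + g u * (if 0 < F u < +oo then 0 else q u).
  by apply/funext => u; case: ifP => _; rewrite ?mule0 ?adde0 ?add0e.
rewrite integ_add//; set I := integ _ _ (fun u => g u * _) w.
suff -> : I = 0 by rewrite adde0.
(* The function [g] need not be bounded; the constant [+oo] dominates it, and pulling that constant
   out leaves [+oo * 0 = 0]. *)
have oo_n : nneg_density (fun _ : V -> R => +oo : \bar R) by split => //;
  exact: measurable_cst.
apply/eqP; rewrite eq_le; apply/andP; split;
  last by have [_] := integ_nneg (mu M) Z gbad_n; exact.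
apply: le_trans (le_integ (mu M) Z gbad_n (nneg_densityM oo_n bad_n) _ w) _.
  move=> u; apply: lee_wpmul2r; first by case: bad_n.
  exact: leey.
by rewrite integZl// bad0 mule0.
Qed.

End Models.
End NoForbiddenTreatment.

(** * Countermodels *)

Section KernelModel.
Variables (V : finType) (R : realType) (e : rel V).
Local Open Scope ereal_scope.
Variables (nu : V -> {sigma_finite_measure set R -> \bar R})
  (k : V -> (V -> R) -> \bar R).
Hypothesis acyclic_e : acyclic e.
Hypothesis kP : forall v, is_kernel nu (parents e v) v (k v).

Let kS (S : {set V}) : {in S, forall v, is_kernel nu (parents e v) v (k v)}.
Proof. by []. Qed.

Let kddo (T : {set V}) (t w : V -> R) :=
  (if agree T t w then 1 else 0) * \prod_(v in ~: T) k v w.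

Let kddo_nneg T t : nneg_density (kddo T t).
Proof. by apply: nneg_densityM; [exact: nneg_density_agree | exact: kernels_nneg]. Qed.

Let kddo_int1 T t : integ nu (~: T) (kddo T t) t = 1.
Proof.
have := congr1 (@^~ t) (integ_kernels acyclic_e (@kS (~: T)) (nneg_density_agree T t) _).
rewrite finset.setCK => -> /=; last exact: depends_on_agree.
by rewrite (_ : agree _ _ _ = true)//; apply/forallP => v; apply/implyP.
Qed.

Let kddo_set0 (t w : V -> R) : kddo finset.set0 t w = \prod_v k v w.
Proof.
rewrite /kddo (_ : agree _ _ _ = true); last by apply/forallP => v; rewrite inE.
by rewrite mul1e finset.setC0; apply: eq_bigl => v; rewrite inE.
Qed.

Definition kernel_model : interventional_model V R :=
  InterventionalModel (fun T t => (kddo_nneg T t).2)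
    (fun T t => (kddo_nneg T t).1) kddo_int1 kddo_set0.

(** The truncated products hold by construction. That each kernel is a conditional density follows
    from [marg_closed] with the descendants of [v] as closed set, the proper ones integrating
    out. *)
Lemma kernel_model_causal : causal_dag kernel_model (dag_graph e).
Proof.
have paE v : pa (dag_graph e) v = parents e v by apply/finset.setP => u; rewrite !inE.
split; first by [].
exists k; split=> [v _|T t w _]; last first.
  by rewrite /marg /= finset.setCT integ_set0 finset.setTD.
have [[mk k0] kd k1] := kP v; rewrite paE; split=> // w.
rewrite /marg /=; have vD : v \in de e [set v] by apply: (fintype.subsetP (sub_de e
  _)); rewrite inE.
have kvE : integ nu (de e [set v] :\ v) (fun w => \prod_(u in de e [set v]) k u w) = k v.
  rewrite (_ : (fun w => _) = fun w => k v w * \prod_(u in de e [set v] :\ v) k u w);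
    last first.
    by apply/funext => u; rewrite (big_setD1 v).
  rewrite (integ_kernels acyclic_e (@kS (de e [set v] :\ v)))//.
  apply: depends_onS kd; apply/fintype.subsetP => u;
    rewrite finset.in_setU1 finset.in_setC finset.in_setD1.
  case/predU1P => [->|]; first by rewrite eqxx.
  rewrite finset.in_set => euv; rewrite negb_and; apply/orP; right;
    apply/negP => /mem_de[a].
  by rewrite finset.in_set1 => /eqP->; exact/negP/acyclic_edge.
rewrite -kvE; apply: (marg_closed acyclic_e kP (B := [set v])) => //.
- exact: de_closed.
- rewrite finset.disjoints_subset; apply/fintype.subsetP => u;
  rewrite finset.in_set finset.in_setC => euv.
  by apply/negP => /mem_de[a]; rewrite finset.in_set1 => /eqP->; exact/negP/acyclic_edge.
- by rewrite finset.sub1set.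
- by rewrite kvE.
Qed.

End KernelModel.

(** * Fair coins and their noisy copies *)

Definition fair_coin (R : realType) : set R -> \bar R :=
  mscale (2^-1 : R)%:nng%R (measure_add (dirac (0 : R)) (dirac (1 : R))).

HB.instance Definition _ (R : realType) := Measure.on (@fair_coin R).

Lemma fair_coin_finite (R : realType) : fin_num_fun (@fair_coin R).
Proof.
move=> A mA; rewrite /fair_coin /mscale.
rewrite [X in (_ * X)%E](_ : _ = dirac (0%R : R) A + dirac (1%R : R) A)%E;
  last exact: measure_addE.
by rewrite !diracE.
Qed.

HB.instance Definition _ (R : realType) :=
  @Measure_isFinite.Build _ _ R (@fair_coin R) (@fair_coin_finite R).

Section CoinKernels.
Variables (V : finType) (R : realType).
Local Open Scope ereal_scope.
Implicit Types (u v r : V) (w : V -> R) (A B S T : {set V}).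

Lemma integral_fair_coin (f : R -> \bar R) :
  measurable_fun [set: R]%classic f -> (forall x, 0 <= f x) ->
  \int[@fair_coin R]_x f x = (2^-1)%:E * (f 0%R + f 1%R).
Proof.
move=> mf f0; rewrite /fair_coin ge0_integral_mscale// ge0_integral_measure_add//.
by rewrite !integral_dirac// !diracT !mul1e.
Qed.

Definition coin_measure (_ : V) : {sigma_finite_measure set R -> \bar R} :=
  @fair_coin R.

(* The bit of a coordinate says whether it equals 1; for a + b = 2 the bits of
   u and v are fair and agree with probability a / 2. *)
Definition pair_kernel (a b : R) u v w : \bar R :=
  (if (w u == 1%R) == (w v == 1%R) then a else b)%:E.

Lemma pair_kernelC a b u v w : pair_kernel a b u v w = pair_kernel a b v u w.
Proof. by rewrite /pair_kernel eq_sym. Qed.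

Lemma pair_kernel_cst a u v w : pair_kernel a a u v w = a%:E.
Proof. by rewrite /pair_kernel if_same. Qed.

Lemma is_kernel_pair A a b u v : (0 <= a)%R -> (0 <= b)%R -> (a + b = 2)%R ->
  u != v -> u \in A -> is_kernel coin_measure A v (pair_kernel a b u v).
Proof.
move=> a0 b0 ab uv uA.
have bit x : measurable_fun [set: g_sigma_algebraType (@cylinders V R)]%classic
    (fun w : g_sigma_algebraType (@cylinders V R) => (w : V -> R) x == 1%R).
  by apply: measurable_fun_eqr; [exact: measurable_coord | exact: measurable_cst].
have pn : nneg_density (pair_kernel a b u v).
  split=> [|w]; last by rewrite lee_fin; case: ifP.
  apply/measurable_EFinP.
  rewrite (_ : (fun w => _) = fun w : V -> R => if w u == 1%R then
      (if w v == 1%R then a else b) else (if w v == 1%R then b else a)); last first.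
    by apply/funext => w; case: (w u == 1%R); case: (w v == 1%R).
  by do !apply: measurable_fun_ifT => //.
split=> // [w w' ww'|w].
  by rewrite /pair_kernel !ww' ?inE ?eqxx ?uA ?orbT.
rewrite integ_set1 integral_fair_coin; last 2 first.
- have [mp _] := pn; exact: (measurableT_comp mp (measurable_set_coord1 w v)).
- by move=> x; have [_] := pn; exact.
rewrite /pair_kernel /set_coord !eqxx (negbTE uv) (_ : (0 == 1 :> R) = false)%R;
  last first.
  by apply/negbTE; rewrite eq_sym oner_neq0.
rewrite -EFinD -EFinM; case: (w u == 1%R) => /=; rewrite ?[(b + a)%R]addrC ab mulVf//.
Qed.

Lemma is_kernel1 A v : is_kernel coin_measure A v (fun=> 1).
Proof.
split=> //; first exact: nneg_density1.
move=> w; rewrite integ_set1 integral_fair_coin//.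
by rewrite -EFinD -EFinM (_ : 1 + 1 = 2)%R// mulVf.
Qed.

Lemma integ_coin1 (S : {set V}) w : integ coin_measure S (fun=> 1) w = 1.
Proof.
have acyclic0 : acyclic (fun _ _ : V => false) by apply: acyclic_intro.
have := integ_kernels1 acyclic0 w (fun v (_ : v \in S) => is_kernel1 (parents (fun _ _
  => false) v) v).
by rewrite (_ : (fun w => _) = fun=> 1)//; apply/funext => u; rewrite big1.
Qed.

End CoinKernels.

(** * Stars of copies *)

Section Star.
Variables (V : finType) (R : realType).
Local Open Scope ereal_scope.
Variables (T : {set V}) (x0 : V) (a b : R).
Hypotheses (a_ge0 : (0 <= a)%R) (b_ge0 : (0 <= b)%R) (ab2 : (a + b = 2)%R).

Let nu : V -> {sigma_finite_measure set R -> \bar R} := @coin_measure V R.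

(** The tree law seen from a centre [r]: its factors need not follow the edges of [e], but any
    marginal containing [r] is simply the product of the factors that remain. *)
Definition star_kernel (r v : V) : (V -> R) -> \bar R :=
  if v \in T then pair_kernel 2 0 r v
  else if v == x0 then pair_kernel a b r v else (fun=> 1).

Let star_rel (r : V) : rel V := [rel u v | (u == r) && (v != r)].

Let acyclic_star r : acyclic (star_rel r).
Proof.
apply: acyclic_intro => u v /andP[/eqP-> vr]; apply/negP => /connectP[[|x p] /=].
  by move=> _ rv; rewrite rv eqxx in vr.
by case/andP=> /andP[/eqP rv _]; rewrite rv eqxx in vr.
Qed.

Let star_kernelP r v : r != v ->
  is_kernel nu (parents (star_rel r) v) v (star_kernel r v).
Proof.
move=> rv; rewrite /star_kernel; have rp : r \in parents (star_rel r) v.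
  by rewrite finset.in_set; apply/andP; rewrite eq_sym.
case: ifP => _; first by apply: is_kernel_pair => //; rewrite addr0.
by case: ifP => _; [exact: is_kernel_pair|exact: is_kernel1].
Qed.

Lemma star_kernel_fin r v w : 0 <= star_kernel r v w < +oo.
Proof.
rewrite /star_kernel /pair_kernel.
by case: ifP => _; [|case: ifP => _]; rewrite ?ltry ?lee_fin ?andbT//; case: ifP.
Qed.

Lemma prod_star_fin r (A : {set V}) w : 0 <= \prod_(v in A) star_kernel r v w < +oo.
Proof.
apply: (big_ind (fun x => 0 <= x < +oo)) => [|x y /andP[x0' xoo] /andP[y0 yoo]|v _].
- by rewrite lee_fin ler01 ltry.
- by rewrite mule_ge0// lte_mul_pinfty// ge0_fin_numE.
- exact: star_kernel_fin.
Qed.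

Lemma marg_star r (A : {set V}) w : r \in A ->
  integ nu (~: A) (fun w => \prod_(v in [set~ r]) star_kernel r v w) w =
  \prod_(v in A :\ r) star_kernel r v w.
Proof.
move=> rA; have kS (B : {set V}) : r \notin B ->
    {in B, forall v, is_kernel nu (parents (star_rel r) v) v (star_kernel r v)}.
  by move=> rB v vB; apply: star_kernelP; apply: contraNneq rB => ->.
have rAC : r \notin ~: A by rewrite finset.in_setC rA.
have rAr : r \notin A :\ r by rewrite finset.in_setD1 eqxx.
rewrite (_ : (fun w => _) = fun w => \prod_(v in A :\ r) star_kernel r v w *
    \prod_(v in ~: A) star_kernel r v w); last first.
  apply/funext => u; rewrite (big_setID A)/=; congr (_ * _); apply: eq_bigl => v.
    by rewrite !inE andbC.
  by rewrite !inE; case: (v =P r) => [->|]; rewrite ?rA ?andbF ?andbT.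
rewrite (integ_kernels (@acyclic_star r) (kS _ rAC))//;
  first exact: (kernels_nneg (kS _ rAr)).
apply: (kernels_depend (kS _ rAr)) => [v|u v _ /andP[/eqP-> _]]; rewrite finset.setCK//.
by rewrite finset.in_setD1 => /andP[].
Qed.

End Star.

(** * Trees of copies along the edges of the graph *)

Section Tree.
Variables (V : finType) (R : realType) (e : rel V).
Local Open Scope ereal_scope.
Hypothesis acyclic_e : acyclic e.
Variables (par : V -> V) (c x0 : V) (a b : R).
Hypotheses (a_ge0 : (0 <= a)%R) (b_ge0 : (0 <= b)%R) (ab2 : (a + b = 2)%R).
Hypothesis ex0c : e x0 c.

Definition tree_set (T : {set V}) :=
  c \in T /\ {in T, forall v, v != c -> par v \in T /\ e (par v) v}.

Definition tree_kernel (T : {set V}) v : (V -> R) -> \bar R :=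
  if v \in T :\ c then pair_kernel 2 0 (par v) v
  else if v == c then pair_kernel a b x0 v else (fun=> 1).

Lemma tree_kernelP T v : tree_set T ->
  is_kernel (@coin_measure V R) (parents e v) v (tree_kernel T v).
Proof.
move=> [cT Tpar]; have ne u x : e u x -> u != x.
  by move=> eux; apply: contraTneq eux => ->; rewrite acyclic_irrefl.
rewrite /tree_kernel; case: ifP => [|_].
  rewrite finset.in_setD1 => /andP[vc vT]; have [_ epv] := Tpar _ vT vc.
  by apply: is_kernel_pair; rewrite ?addr0 ?inE//; exact: ne.
case: eqP => [->|_]; last exact: is_kernel1.
by apply: is_kernel_pair; rewrite ?inE//; exact: ne.
Qed.

Lemma prod_indicator2 (S : {set V}) (P : pred V) :
  \prod_(v in S) (if P v then 2 else 0 : R)%:E =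
  (if [forall v in S, P v] then 2 ^+ #|S| else 0 : R)%:E.
Proof.
case: ifPn => [/forall_inP PS|/forall_inPn[v vS /negbTE Pv]]; last first.
  by rewrite (bigD1 v)//= Pv mul0e.
by rewrite prodEFin -prodr_const; congr EFin; apply: eq_bigr => v /PS ->.
Qed.

(* Copying is symmetric, so any node of the tree can serve as the root. *)
Lemma tree_star T r w : tree_set T -> x0 \notin T -> r \in T ->
  \prod_v tree_kernel T v w = \prod_(v in [set~ r]) star_kernel T x0 a b r v w.
Proof.
move=> [cT Tpar] x0T rT; pose bit v := w v == 1%R.
have lhsE : \prod_v tree_kernel T v w = pair_kernel a b x0 c w *
    \prod_(v in T :\ c) pair_kernel 2 0 (par v) v w.
  rewrite (bigD1 c)//= {1}/tree_kernel finset.in_setD1 eqxx; congr (_ * _).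
  rewrite (bigID (mem T))/= [X in _ * X]big1 ?mule1 => [|v /andP[vc /negbTE vT]].
    apply: eq_big => [v|v]; first by rewrite finset.in_setD1.
    by case/andP=> vc vT; rewrite /tree_kernel finset.in_setD1 vc vT.
  by rewrite /tree_kernel finset.in_setD1 vT andbF (negbTE vc).
have x0r : x0 != r by apply: contraNneq x0T => ->.
have rhsE : \prod_(v in [set~ r]) star_kernel T x0 a b r v w = pair_kernel a b r x0 w *
    \prod_(v in T :\ r) pair_kernel 2 0 r v w.
  rewrite (bigD1 x0)/=; last by rewrite !inE.
  rewrite {1}/star_kernel (negbTE x0T) eqxx; congr (_ * _).
  rewrite (bigID (mem T))/= [X in _ * X]big1 ?mule1 => [|v /andP[/andP[_ vx0] /negbTE
    vT]].
    apply: eq_big => [v|v].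
      rewrite !inE; case: (boolP (v \in T)) => vT; rewrite ?andbF// !andbT.
      by rewrite (_ : v != x0) ?andbT//; apply: contraTneq vT => ->.
    by case/andP=> _ vT; rewrite /star_kernel vT.
  by rewrite /star_kernel vT (negbTE vx0).
rewrite lhsE rhsE !prod_indicator2.
have cardE : #|T :\ c| = #|T :\ r|.
  by have := cardsD1 c T; rewrite (cardsD1 r T) cT rT !add1n => -[].
have same_bits : [forall v in T :\ c, bit (par v) == bit v] ->
    {in T, forall v, bit v = bit c}.
  move=> /forall_inP step v vT; apply: (contraTeq _ isT) => vc.
  have acyclic_rev : acyclic (fun x y => e y x).
    apply: acyclic_intro => x y eyx.
    by rewrite (connect_rev e) /=; exact: acyclic_edge.
  (* A node of [T] earliest among those whose bit differs from that of [c] has a parent in [T] with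
     the same bit, a contradiction. *)
  have [|u] := @acyclic_sink _ _ acyclic_rev [set u in T | bit u != bit c].
    by apply/set0Pn; exists v; rewrite inE vT.
  rewrite inE => /andP[uT uc] source_u.
  have uNc : u != c by apply: contraNneq uc => ->.
  have [pT epu] := Tpar _ uT uNc.
  have /eqP pu : bit (par u) == bit u by apply: step; rewrite finset.in_setD1 uNc.
  have := source_u (par u); rewrite inE pT pu uc => /(_ isT).
  by rewrite epu.
have -> : [forall v in T :\ c, bit (par v) == bit v] = [forall v in T :\ r, bit r ==
  bit v].
  apply/idP/forall_inP => [/same_bits eqc v|eqr].
    by rewrite finset.in_setD1 => /andP[_ vT]; rewrite !eqc.
  have eqr' v : v \in T -> bit v = bit r.
    move=> vT; have [->//|vr] := eqVneq v r.
    by have := eqr v; rewrite finset.in_setD1 vr vT => /(_ isT) /eqP ->.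
  apply/forall_inP => v; rewrite finset.in_setD1 => /andP[vc vT].
  by have [pT _] := Tpar _ vT vc; rewrite !eqr'.
case: ifP => [eqr|_]; last by rewrite !mule0.
rewrite cardE; congr (_ * _); rewrite pair_kernelC /pair_kernel.
have [->//|cr] := eqVneq c r.
move/forall_inP: eqr => /(_ c); rewrite finset.in_setD1 cr cT => /(_ isT) /eqP.
by rewrite /bit => ->.
Qed.

(** Intervening prunes the tree: the truncated product is the full density of a smaller tree, to
    which [tree_star] applies again. *)
Lemma tree_kernelD (T X : {set V}) w : c \notin X ->
  \prod_(v in ~: X) tree_kernel T v w = \prod_v tree_kernel (T :\: X) v w.
Proof.
move=> cX; rewrite [RHS](bigID (mem X))/= [X in _ = X * _]big1 ?mul1e.
  apply: eq_big => [v|v]; first by rewrite inE.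
  by rewrite inE => vX; rewrite /tree_kernel !inE vX.
move=> v vX; rewrite /tree_kernel !inE vX andbF /=.
by case: eqP vX cX => [->->|].
Qed.

End Tree.

(** * Refuting a proposed adjustment set *)

Section Countermodels.
Variables (V : finType) (R : realType) (e : rel V) (X Z : {set V}) (Y : V).
Local Open Scope ereal_scope.
Hypothesis acyclic_e : acyclic e.
Hypothesis ZXY : Z \subset ~: (X :|: [set Y]).
Variables (par : V -> V) (c x0 : V).
Hypotheses (x0X : x0 \in X) (ex0c : e x0 c) (cX : c \notin X).

Section TreeModel.
Variables (a b : R).
Hypotheses (a_ge0 : (0 <= a)%R) (b_ge0 : (0 <= b)%R) (ab2 : (a + b = 2)%R).
Variable T : {set V}.
Hypotheses (treeT : tree_set e par c T).

Definition tree_model : interventional_model V R :=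
  kernel_model acyclic_e (fun v =>
    tree_kernelP acyclic_e a_ge0 b_ge0 ab2 ex0c v treeT).

Lemma tree_model_causal : causal_dag tree_model (dag_graph e).
Proof. exact: kernel_model_causal. Qed.

Hypothesis x0T : x0 \notin T.

Lemma marg_tree r (A : {set V}) w : r \in T -> r \in A ->
  marg tree_model A (dens tree_model) w =
  \prod_(v in A :\ r) star_kernel T x0 a b r v w.
Proof.
move=> rT rA; rewrite -(marg_star T x0 a_ge0 b_ge0 ab2 w rA) /marg /=.
by congr (integ _ _ _ w); apply/funext => u; exact: tree_star treeT x0T rT.
Qed.

(** Centred at [Y], the pruned tree links no treatment but [x0], so a single noisy factor
    survives. *)
Lemma do_tree w : tree_set e par c (T :\: X) -> Y \in T -> Y \notin X ->
  do_density tree_model X Y w = pair_kernel a b Y x0 w.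
Proof.
move=> treeTX YT YX; have x0TX : x0 \notin T :\: X by rewrite finset.in_setD x0X.
rewrite (do_densityE (e := e) (k := tree_kernel par c x0 a b T))//; last first.
  by move=> v; exact: tree_kernelP.
have YTX : Y \in T :\: X by rewrite finset.in_setD YX.
rewrite [mu _]/= (_ : (fun u => _) =
    fun u => \prod_(v in [set~ Y]) star_kernel (T :\: X) x0 a b Y v u); last first.
  apply/funext => u; rewrite tree_kernelD//.
  exact: tree_star treeTX x0TX YTX.
rewrite marg_star ?finset.setU11// finset.setU1K// (bigD1 x0)//= big1 ?mule1.
  by rewrite /star_kernel (negbTE x0TX) eqxx.
move=> v /andP[vX /negbTE vx0].
by rewrite /star_kernel finset.in_setD vX vx0.
Qed.

End TreeModel.

(** All bits agree at this point, so every [pair_kernel] takes its first value there. *)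
Let w0 : V -> R := fun=> 0%R.

Let nZ u : u \in Z -> u \notin X /\ u != Y.
Proof.
by move=> /(fintype.subsetP ZXY); rewrite finset.in_setC finset.in_setU finset.in_set1
  negb_or => /andP.
Qed.

(* The treatment x0 influences c through noise, Y copies c, and so does some
   node of Z: given Z, the treatment carries no information on Y. *)
Lemma downstream_not_valid (T : {set V}) n : tree_set e par c T ->
  [disjoint X & T] -> Y \in T -> n \in T -> n \in Z ->
  ~ valid_adjustment_set R e X Y Z.
Proof.
move=> treeT XT YT nT nZ' [_ valid].
(* [b > 0] keeps [f(x, z)] positive wherever [f(z)] is, as [positivity] requires; [a <> 1] separates
   the interventional density of [Y] from its marginal. *)
pose a : R := (3 / 2)%R; pose b : R := (2^-1)%R.
have a0 : (0 <= a)%R by rewrite divr_ge0.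
have b0 : (0 <= b)%R by rewrite invr_ge0.
have ab : (a + b = 2)%R by rewrite /a /b; lra.
have XT' v : v \in X -> v \notin T by move=> vX; rewrite (disjointFr XT vX).
have x0T := XT' _ x0X.
pose M := tree_model a0 b0 ab treeT.
have margE r (A : {set V}) u : r \in T -> r \in A ->
    marg M A (dens M) u = \prod_(v in A :\ r) star_kernel T x0 a b r v u.
  exact: marg_tree.
have [nX nY] := nZ nZ'.
have YX : Y \notin X by rewrite (disjointFl XT YT).
have YZ : Y \notin Z by apply/negP => /nZ[_]; rewrite eqxx.
have XZ v : v \in X -> v \notin Z by move=> vX; apply/negP => /nZ[]; rewrite vX.
pose q u := marg M Z (dens M) u; pose F u := marg M (X :|: Z) (dens M) u.
have qE u : q u = \prod_(v in Z :\ n) star_kernel T x0 a b n v u by exact: margE.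
have FE u : F u = pair_kernel a b n x0 u * q u.
  rewrite /F (margE n (X :|: Z))//; last by rewrite finset.in_setU nZ' orbT.
  rewrite (big_setID X)/= qE; congr (_ * _).
    rewrite (_ : _ :&: _ = X); last first.
      by apply/finset.setP => v; rewrite !inE; case: (boolP (v \in X)) => [vX|];
        rewrite ?andbF// andbT orTb andbT; apply: contraTneq vX => ->.
    rewrite (bigD1 x0)//= big1 ?mule1 => [|v /andP[/XT'/negbTE vT /negbTE vx0]].
      by rewrite /star_kernel (negbTE x0T) eqxx.
    by rewrite /star_kernel vT vx0.
  apply: eq_bigl => v; rewrite !inE; case: (boolP (v \in X)) => [/XZ/negbTE ->|] //=.
  by rewrite andbF.
have q_fin u : 0 <= q u < +oo by rewrite qE prod_star_fin.
have F_good u : q u = 0 \/ 0 < F u < +oo.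
  have /andP[q0 qoo] := q_fin u; have [->|qn] := eqVneq (q u) 0; first by left.
  have qp : 0 < q u by rewrite lt_def qn.
  have pp : 0 < pair_kernel a b n x0 u by rewrite lte_fin; case: ifP => _;
    rewrite /a /b; lra.
  right; rewrite FE mule_gt0//= lte_mul_pinfty// ?ltW//.
have pos : positivity M X Z w0.
  rewrite /positivity (_ : (fun u => _) = fun=> 0) ?integ_zero//.
  apply/funext => u; rewrite -/(F u) -/(q u).
  by case: (F_good u) => ->; rewrite ?if_same.
have := valid M (tree_model_causal _ _ _ _) w0 pos.
rewrite do_tree//; last first.
  by rewrite (_ : T :\: X = T)//; apply/finset.setDidPl; rewrite disjoint_sym.
rewrite /adjustment (_ : (Z == finset.set0) = false); last first.
  by apply/negbTE/set0Pn; exists n.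
(* Both [Y] and [x0] hang on [n], so the factor of [x0] cancels in the ratio and the integrand is
   [f(y, z)]. Integrating over [z] leaves a fair coin of density [1], against [a] under the
   intervention. *)
rewrite (_ : (fun u => _) = marg M (Y |: Z) (dens M)); last first.
  apply/funext => u; rewrite (margE n (Y |: Z)) ?finset.in_setU1 ?nZ' ?orbT//.
  rewrite (_ : (Y |: Z) :\ n = Y |: (Z :\ n)); last first.
    by apply/finset.setP => v; rewrite !inE; case: (v =P Y) => [->|];
      rewrite ?andbT//= eq_sym.
  rewrite finset.big_setU1 ?inE ?negb_and ?YZ ?orbT//= -qE -/(q u).
  rewrite /cond_ratio -/(F u) (margE n (Y |: (X :|: Z)))//;
    last by rewrite !inE nZ' !orbT.
  rewrite (_ : (Y |: (X :|: Z)) :\ n = Y |: ((X :|: Z) :\ n)); last first.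
    by apply/finset.setP => v; rewrite !inE; case: (v =P Y) => [->|];
      rewrite ?andbT//= eq_sym.
  rewrite finset.big_setU1; last by rewrite !inE (negbTE YX) (negbTE YZ) andbF.
  rewrite /= -(margE n (X :|: Z))//; last by rewrite finset.in_setU nZ' orbT.
  rewrite -/(F u); case: (F_good u) => [->|Fu]; first by rewrite !mule0.
  by rewrite mul_div_ereal ?Fu//; case/andP: Fu => /ltW.
rewrite /marg [X in _ = X](_ : _ = 1); last first.
  rewrite -integ_setU; last 2 first.
  - have kn := kernels_nneg (S := [set: V]) (fun v _ => tree_kernelP acyclic_e a0 b0 ab
    ex0c v treeT).
    by move: kn; congr nneg_density; apply/funext => u /=; apply: eq_bigl => v;
      rewrite inE.
  - rewrite disjoint_sym finset.disjoints_subset; apply/fintype.subsetP => v.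
    by rewrite !inE negb_or => /andP[].
  rewrite (_ : Z :|: _ = ~: [set Y]); last first.
    apply/finset.setP => v; rewrite !inE negb_or; case: (v =P Y) => [->|];
      rewrite ?(negbTE YZ)//=.
    by rewrite orbN.
  rewrite -/(marg M [set Y] (dens M) w0) (margE Y) ?inE//.
  by rewrite finset.setDv big_set0.
by rewrite /pair_kernel eqxx => -[]; rewrite /a; lra.
Qed.

(* The treatment x and Y both copy c, which Z does not see; intervening on x
   makes Y uniform. *)
Lemma confounded_not_valid (T : {set V}) x : tree_set e par c T ->
  T :&: X = [set x] -> tree_set e par c (T :\ x) -> x0 \notin T ->
  [disjoint T & Z] -> Y \in T -> Y \notin X ->
  ~ valid_adjustment_set R e X Y Z.
Proof.
move=> treeT TX treeTx x0T TZ YT YX [_ valid].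
(* With [a = b = 1] the link from [x0] carries no information. The contradiction will be between
   density [1] for [Y] under the intervention and density [2] given its copy [x]. *)
have ge1 : (0 <= 1 :> R)%R by []. have e11 : (1 + 1 = 2 :> R)%R by [].
pose M := tree_model ge1 ge1 e11 treeT.
have margE r (A : {set V}) u : r \in T -> r \in A ->
    marg M A (dens M) u = \prod_(v in A :\ r) star_kernel T x0 1 1 r v u.
  exact: marg_tree.
have /finset.setIP[xT xX] : x \in T :&: X by rewrite TX inE.
have TDX : T :\: X = T :\ x by rewrite -TX finset.setDIr finset.setDv finset.set0U.
have xY : x != Y by apply: contraNneq YX => <-.
have YZ : Y \notin Z by rewrite (disjointFr TZ YT).
have star1 v u : v \notin T -> star_kernel T x0 1 1 x v u = 1.
  by move=> /negbTE vT; rewrite /star_kernel vT; case: ifP => // _;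
    rewrite pair_kernel_cst.
have FE u : marg M (X :|: Z) (dens M) u = 1.
  rewrite (margE x)//; last by rewrite finset.in_setU xX.
  apply: big1 => v; rewrite finset.in_setD1 finset.in_setU => /andP[vx vXZ]; apply: star1.
  apply/negP => vT; case/orP: vXZ => [vX|vZ]; last by rewrite (disjointFr TZ vT) in vZ.
  have : v \in T :&: X by rewrite finset.in_setI vT.
  by rewrite TX inE (negbTE vx).
have ratioE u : cond_ratio M Y (X :|: Z) u = pair_kernel 2 0 x Y u.
  rewrite /cond_ratio FE inve1 mule1 (margE x)//; last by rewrite !inE xX !orbT.
  rewrite (_ : (Y |: (X :|: Z)) :\ x = Y |: ((X :|: Z) :\ x)); last first.
    by apply/finset.setP => v; rewrite !inE; case: (v =P Y) => [->|];
      rewrite ?andbT//= eq_sym.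
  rewrite finset.big_setU1; last by rewrite !inE (negbTE YX) (negbTE YZ) andbF.
  rewrite /= -(margE x (X :|: Z))//; last by rewrite finset.in_setU xX.
  by rewrite FE mule1 /star_kernel YT.
have dens_n : nneg_density (dens M).
  have kn := kernels_nneg (S := [set: V]) (fun v _ => tree_kernelP acyclic_e ge1 ge1
    e11 ex0c v treeT).
  by move: kn; congr nneg_density; apply/funext => u /=; apply: eq_bigl => v; rewrite inE.
have xZ : x \notin Z by rewrite (disjointFr TZ xT).
have qE u : marg M Z (dens M) u = 1.
  (* [marg_tree] needs the centre inside the set, so [x] is kept at first and integrated out
     afterwards. *)
  rewrite /marg (@integ_setD _ _ _ _ (~: (x |: Z)))//; last first.
    by rewrite finset.setCS finset.subsetUr.
  rewrite (_ : _ :\: _ = [set x]); last first.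
    by apply/finset.setP => v; rewrite !inE; case: (v =P x) => [->|]; rewrite ?xZ//=;
      case: (v \in Z).
  rewrite (_ : integ _ (~: _) _ = fun=> 1); last first.
    apply/funext => t; rewrite -/(marg M _ _ t) (margE x) ?finset.setU11//.
    by rewrite finset.setU1K// big1// => v vZ; apply: star1; rewrite (disjointFl TZ vZ).
  by have [_ _] := @is_kernel1 V R finset.set0 x; exact.
have pos : positivity M X Z w0.
  rewrite /positivity (_ : (fun u => _) = fun=> 0) ?integ_zero//.
  by apply/funext => u; rewrite FE lte01 ltry.
have pair2 : pair_kernel 2 0 x Y w0 = 2%:E by rewrite /pair_kernel eqxx.
have := valid M (tree_model_causal _ _ _ _) w0 pos.
rewrite do_tree ?TDX// pair_kernel_cst /adjustment; case: eqP => [Z0|_].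
  rewrite (_ : cond_ratio M Y X w0 = 2%:E);
    last by rewrite -pair2 -ratioE Z0 finset.setU0.
  by move=> []; lra.
rewrite (_ : (fun u => _) = fun u => pair_kernel 2 0 x Y u * 1); last first.
  by apply/funext => u; rewrite ratioE qE.
have [pn pd _] : is_kernel (@coin_measure V R) [set x] Y (pair_kernel 2 0 x Y).
  by apply: is_kernel_pair; rewrite ?addr0 ?inE.
rewrite integZl//; last 2 first.
- exact: nneg_density1.
- apply: depends_onS pd; apply/fintype.subsetP => v; rewrite !inE.
  by case/orP => /eqP ->.
rewrite pair2 integ_coin1 mule1 => -[]; lra.
Qed.

End Countermodels.

(** * The equivalence *)

Lemma meets_X_not_valid (R : realType) (V : finType) (e : rel V) (X Z : {set V})
    (Y : V) : acyclic e -> Y \notin X -> ~~ [disjoint X & de e (cn e X Y)] ->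
  ~ valid_adjustment_set R e X Y Z.
Proof.
move=> acyclic_e YX /(meets_X_witness acyclic_e)[x0 [c [p [x
  [[x0X xX] cX ex0c cY [cp epx]]]]]] valid.
have [ZXY _] := valid.
pose T := [set v | connect (avoiding e X) c v].
(* Any parent in [T] will do, since acyclicity rules out loops; the default [c] is taken only by
   nodes with no parent in [T]. *)
pose par v := odflt c [pick u in T | e u v].
have parP u v : u \in T -> e u v -> par v \in T /\ e (par v) v.
  by move=> uT euv; rewrite /par; case: pickP => [t /andP[]//|/(_ u)]; rewrite uT euv.
have treeT : tree_set e par c T.
  split=> [|v]; rewrite [_ \in T]finset.in_set // => /connectP[q];
    case/lastP: q => [_ ->|q z]; first by rewrite eqxx.
  rewrite rcons_path last_rcons => /andP[cq /andP[eqz _]] -> _.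
  by apply: parP eqz; rewrite inE; apply/connectP; exists q.
have TX v : v \in T -> v \notin X by rewrite inE => cv; exact: avoiding_notin cv cX.
have YT : Y \in T by rewrite inE.
have pT : p \in T by rewrite inE.
have [TZ|] := boolP [disjoint T & Z]; last first.
  case/pred0Pn=> n /andP[/= nT nZ].
  apply: (downstream_not_valid acyclic_e ZXY x0X ex0c cX treeT _ YT nT nZ) valid.
  by rewrite disjoint_sym finset.disjoints_subset; apply/fintype.subsetP => v /TX;
    rewrite inE.
have xT : x \notin T by apply: contraL xX => /TX.
apply: (confounded_not_valid (T := x |: T) (x := x) (par := par)
  acyclic_e x0X ex0c cX _ _ _ _ _ _ YX) valid.
- have [cT Tpar] := treeT; split=> [|v]; first by rewrite finset.in_setU1 cT orbT.
  rewrite finset.in_setU1 => vxT vc.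
  have [pvT epv] : par v \in T /\ e (par v) v.
    by case/predU1P: vxT => [->|vT]; [exact: parP pT epx | exact: Tpar].
  by rewrite finset.in_setU1 pvT orbT.
- apply/finset.setP => v; rewrite !finset.inE; case: (v =P x) => [->|_] /=; first by [].
  by apply/negP => /andP[vT]; apply/negP/TX; rewrite inE.
- by rewrite finset.setU1K.
- rewrite finset.in_setU1 negb_or; apply/andP; split; last by apply: contraL x0X => /TX.
  (* [x0 = x] would close the cycle [x0 -> c -> ... -> p -> x]. *)
  have := acyclic_edge acyclic_e ex0c; apply: contraNneq => ->.
  by apply: connect_trans (connect1 epx); exact: avoiding_connect cp.
- rewrite finset.disjoints_subset finset.subUset finset.sub1set.
  rewrite -finset.disjoints_subset TZ andbT finset.in_setC.
  apply: contraL xX => /(fintype.subsetP ZXY).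
  by rewrite finset.in_setC finset.in_setU negb_or => /andP[].
- by rewrite finset.in_setU1 YT orbT.
Qed.

Theorem proposition7 (R : realType) (V : finType) (e : rel V)
    (M : interventional_model V R) (X : {set V}) (Y : V)
    (causal_D : causal_dag M (dag_graph e))
    (disjoint_XY : [disjoint X & [set Y]])
    (Y_de_X : Y \in de e X)
    (X_not_de_Y : [disjoint X & de e [set Y]]) :
  causal_dag M (forbidden_projection e X Y) <->
  exists Z : {set V}, valid_adjustment_set R e X Y Z.
Proof.
have [[_ acyclic_e] _] := causal_D.
have YX : Y \notin X by rewrite (disjointFl disjoint_XY) ?inE.
(* The passage from the single [M] to all models in the definition of validity goes through the
   graph: absence of bidirected edges is a statement about [e] alone. *)
split=> [[[no_bidir _] _]|[Z validZ]]; last first.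
  apply: causal_dag_projection => //; apply: contraT => meetsX.
  by case: (meets_X_not_valid acyclic_e YX meetsX validZ).
have XD0 : [disjoint X & de e (cn e X Y)].
  apply: contraT => meetsX.
  have [x xX xY] := bidirected_of_meets_X acyclic_e Y_de_X X_not_de_Y meetsX.
  have := no_bidir x Y; rewrite /= => /negP[]; apply/and4P; split.
  - by rewrite !finset.in_setU xX orbT.
  - by rewrite !finset.in_setU finset.set11 orbT.
  - by apply: contraNneq YX => <-.
  - exact/asboolP.
exists (~: de e X); split; last first.
  by move=> N causal_N w; exact: adjustment_nondescendants.
rewrite finset.setCS finset.subUset sub_de finset.sub1set //.
Qed.
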